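(* Let $m$ be a positive integer, $d=2^m$, and let $f:S^1\to\mathbb{C}$ satisfy $\|f\|_\infty\le 1$. Given an $n$-qubit black-box unitary $U$ and a unitary $U_{f,4d}$ that is a diagonal encoding of $f$ (an $(m+3)$-qubit unitary with $\langle j'|\langle 0|U_{f,4d}|j\rangle|0\rangle=\delta_{jj'}f(e^{2\pi i j/4d})$ for all $j,j'\in\{0,\dots,4d-1\}$), one can construct a $(\sqrt{2},\,m+3,\,(1+\sqrt{2})E_d(f))$-block encoding of $f(U)$ by a quantum circuit that makes $4d-1$ uses of controlled-$U$ and $4d-1$ uses of controlled-$U^\dagger$, one use of $U_{f,4d}$, and $O(m^2)$ additional single- and two-qubit gates. Moreover, the circuit description for this block encoding can be computed in $\mathrm{poly}(m)$ time on a classical computer.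
   Context: $S^1=\{z\in\mathbb{C}:|z|=1\}$ and $\|f\|_\infty=\sup_{z\in S^1}|f(z)|$. An $n$-qubit unitary is a unitary operator on $\mathbb{C}^{2^n}$; for unitary $U$, $f(U)$ is defined through the spectral decomposition of $U$. Diagonal encoding: in $U_{f,4d}$ the states $|j\rangle$, $0\le j\le 4d-1$, are the computational basis states of $m+2$ qubits and $|0\rangle$ is a state of one further qubit. Block encoding: for a $2^n\times 2^n$ matrix $A$, $\alpha>0$, $\epsilon\ge 0$, an $(n+a)$-qubit unitary $U_A$ is an $(\alpha,a,\epsilon)$-block encoding of $A$ if $\|A-\alpha\langle 0^a|U_A|0^a\rangle\|\le\epsilon$ in operator norm, where $\langle 0^a|U_A|0^a\rangle$ is the $2^n\times 2^n$ block of $U_A$ obtained by fixing the $a$ ancilla qubits to $|0^a\rangle$ on input and output. Best approximation error: $\mathbb{C}_d[z,z^{-1}]$ is the set of Laurent polynomials $\sum_{j=-d}^{d}\beta_j z^j$ with $\beta_j\in\mathbb{C}$, and $E_d(f)=\min_{g\in\mathbb{C}_d[z,z^{-1}]}\|f-g\|_\infty$. Controlled-$U$ is $|0\rangle\langle 0|\otimes \mathbb{1}+|1\rangle\langle 1|\otimes U$ (and likewise for $U^\dagger$). $U$, $U^\dagger$ (in controlled form) and $U_{f,4d}$ are treated as black-box gates; in the circuit description, the repetition of a black-box gate (e.g. a controlled power $U^{2^k}$) may be specified by giving the number of repetitions. *)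

(* Defs.v *)
(* The complex field is R[i], for an arbitrary R : realType. *)
From HB Require Import structures.
From mathcomp Require Import all_boot all_order all_algebra.
From mathcomp Require Import mxtens complex.
From mathcomp Require Import all_classical all_reals all_analysis.

Set Implicit Arguments.
Unset Strict Implicit.
Unset Printing Implicit Defensive.

Import Order.TTheory GRing.Theory Num.Theory.
Local Open Scope classical_set_scope.
Local Open Scope ring_scope.
Local Open Scope complex_scope.
Local Open Scope sesquilinear_scope.

Section ComplexAnalysis.
Variable R : realType.

Definition modulus (z : R[i]) : R := complex.Re `|z|.

Definition S1 : set R[i] := [set z | modulus z = 1].

Definition expi (t : R) : R[i] := cos t +i* sin t.

(* Extended-real valued, so that an unbounded f has norm +oo. *)
Definition supnorm (f : R[i] -> R[i]) : \bar R :=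
  ereal_sup [set (modulus (f z))%:E | z in S1].

Definition laurent (d : nat) (beta : int -> R[i]) (z : R[i]) : R[i] :=
  \sum_(k < (2 * d).+1) beta (k%:Z - d%:Z) * z ^ (k%:Z - d%:Z).

(* An infimum over a finite-dimensional space, hence a minimum for bounded f. *)
Definition best_error (d : nat) (f : R[i] -> R[i]) : \bar R :=
  ereal_inf [set supnorm (fun z => f z - laurent d beta z) | beta in setT].

Definition vnorm k (v : 'cV[R[i]]_k) : R :=
  Num.sqrt (\sum_i modulus (v i 0) ^+ 2).

(* The set is nonempty and bounded, so the real-valued sup is the true one. *)
Definition opnorm k (A : 'M[R[i]]_k) : R :=
  sup [set vnorm (A *m v) | v in [set v : 'cV_k | vnorm v <= 1]].

(* f(U), for U unitary (or merely normal): U = V^-1 diag(lambda) V with V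
   unitary is the content of orthomx_spectralP. *)
Definition fun_mx k (f : R[i] -> R[i]) (U : 'M[R[i]]_k) : 'M[R[i]]_k :=
  invmx (spectralmx U) *m diag_mx (map_mx f (spectral_diag U)) *m spectralmx U.

End ComplexAnalysis.

(* Basis states of N qubits are the integers x < 2 ^ N, read in big-endian
   order: wire 0 carries the most significant bit, so that |i>|j> is the state
   i * 2 ^ l + j when |j> has l qubits. *)

Definition ket0 k : 'I_(2 ^ k) := Ordinal (expn_gt0 2 k).

Definition ketD k l (i : 'I_(2 ^ k)) (j : 'I_(2 ^ l)) : 'I_(2 ^ (k + l)) :=
  cast_ord (esym (expnD 2 k l)) (mxtens_index (i, j)).

Definition bit (N x w : nat) : bool := odd (x %/ 2 ^ (N - w.+1)).

(* The state of the k wires ws (first one most significant) when the N-qubit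
   register is in the basis state x; the insubd default is never used, the
   sum being always less than 2 ^ k. *)
Definition subket N k (ws : seq nat) (x : 'I_(2 ^ N)) : 'I_(2 ^ k) :=
  insubd (ket0 k) (\sum_(i < k) bit N x (nth 0 ws i) * 2 ^ (k - i.+1))%N.

Section Circuits.
Variable R : realType.

(* G acting on the wires ws of an N-qubit register, the identity elsewhere. *)
Definition apply_on N k (ws : seq nat) (G : 'M[R[i]]_(2 ^ k)) :
    'M[R[i]]_(2 ^ N) :=
  \matrix_(x, y)
    if [forall w : 'I_N, (val w \in ws) || (bit N x w == bit N y w)]
    then G (subket k ws x) (subket k ws y) else 0.

(* |0><0| (x) 1 + |1><1| (x) G *)
Definition controlled k (G : 'M[R[i]]_(2 ^ k)) : 'M[R[i]]_(2 ^ k.+1) :=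
  castmx (esym (expnS 2 k), esym (expnS 2 k))
    ((delta_mx 0 0 : 'M[R[i]]_2) *t 1%:M + (delta_mx 1 1 : 'M[R[i]]_2) *t G).

Inductive gate :=
| Gate1 of 'M[R[i]]_(2 ^ 1) & nat
| Gate2 of 'M[R[i]]_(2 ^ 2) & nat & nat
| CtrlU of nat
| CtrlUadj of nat
| UseF of seq nat.

Definition is_elementary (g : gate) : bool :=
  match g with Gate1 _ _ | Gate2 _ _ _ => true | _ => false end.
Definition is_ctrlU (g : gate) : bool :=
  if g is CtrlU _ then true else false.
Definition is_ctrlUadj (g : gate) : bool :=
  if g is CtrlUadj _ then true else false.
Definition is_useF (g : gate) : bool :=
  if g is UseF _ then true else false.

(* In a circuit with a ancilla qubits and n system qubits, the ancillas are
   the wires 0, ..., a - 1 and the system the wires a, ..., a + n - 1;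
   U acts on the system and its control is an ancilla; the black box F acts
   on k qubits. *)
Definition gate_wf (a n k : nat) (g : gate) : Prop :=
  match g with
  | Gate1 A w => A \is unitarymx /\ (w < a + n)%N
  | Gate2 A w w' =>
      [/\ A \is unitarymx, (w < a + n)%N, (w' < a + n)%N & w != w']
  | CtrlU c | CtrlUadj c => (c < a)%N
  | UseF ws => [/\ size ws = k, uniq ws & all (fun w => w < a + n)%N ws]
  end.

Definition circuit_wf a n k (C : seq gate) : Prop :=
  forall i, (i < size C)%N -> gate_wf a n k (nth (CtrlU 0) C i).

Definition gate_mx a n k (U : 'M[R[i]]_(2 ^ n)) (F : 'M[R[i]]_(2 ^ k))
    (g : gate) : 'M[R[i]]_(2 ^ (a + n)) :=
  match g with
  | Gate1 A w => apply_on (a + n) [:: w] A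
  | Gate2 A w w' => apply_on (a + n) [:: w; w'] A
  | CtrlU c => apply_on (a + n) (c :: iota a n) (controlled U)
  | CtrlUadj c => apply_on (a + n) (c :: iota a n) (controlled (U ^t*))
  | UseF ws => apply_on (a + n) ws F
  end.

(* The first gate of the list is applied first. *)
Definition circuit_mx a n k U F (C : seq gate) : 'M[R[i]]_(2 ^ (a + n)) :=
  foldl (fun M g => @gate_mx a n k U F g *m M) 1%:M C.

(* <0^a| W |0^a> *)
Definition anc_block a n (W : 'M[R[i]]_(2 ^ (a + n))) : 'M[R[i]]_(2 ^ n) :=
  \matrix_(i, j) W (ketD (ket0 a) i) (ketD (ket0 a) j).

Definition block_encoding n (alpha : R) (a : nat) (eps : R)
    (W : 'M[R[i]]_(2 ^ (a + n))) (A : 'M[R[i]]_(2 ^ n)) : Prop :=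
  W \is unitarymx /\ opnorm (A - alpha%:C *: anc_block W) <= eps.

(* Diagonal encoding of f at the 2 ^ k-th roots of unity. *)
Definition diagonal_encoding k (f : R[i] -> R[i])
    (F : 'M[R[i]]_(2 ^ (k + 1))) : Prop :=
  forall j j' : 'I_(2 ^ k),
    F (ketD j' (ket0 1)) (ketD j (ket0 1)) =
    if j == j' then f (expi (2 * pi * j%:R / (2 ^ k)%:R)) else 0.

End Circuits.

Arguments Gate1 {R}.
Arguments Gate2 {R}.
Arguments CtrlU {R}.
Arguments CtrlUadj {R}.
Arguments UseF {R}.
Arguments gate_mx {R} a {n k}.
Arguments circuit_mx {R} a {n k}.
Arguments circuit_wf {R}.
Arguments block_encoding {R n} alpha%_R a%_N eps%_R W A.

(* Circuit descriptions.  Elementary gates are named: Phase p k is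
   diag(1, exp(2 i pi p / 2 ^ k)), and the two-qubit gates are the controlled
   versions of the named single-qubit gates.  DCtrlU c r stands for r
   successive uses of controlled-U with control wire c. *)
Inductive gate_name := Hadamard | PauliX | Phase of nat & nat.

Inductive instr :=
| DGate of gate_name & nat
| DCGate of gate_name & nat & nat
| DCtrlU of nat & nat
| DCtrlUadj of nat & nat
| DUseF of seq nat.

Section Denotation.
Variable R : realType.

Definition name_mx (g : gate_name) : 'M[R[i]]_(2 ^ 1) :=
  match g with
  | Hadamard => \matrix_(x, y) ((Num.sqrt 2)^-1 * (-1) ^+ (x * y))%:C
  | PauliX => \matrix_(x, y) (x != y)%:R
  | Phase p k => \matrix_(x, y)
      if x == y then expi (x%:R * (2 * pi * p%:R / (2 ^ k)%:R)) else 0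
  end.

Definition instr_gates (i : instr) : seq (gate R) :=
  match i with
  | DGate g w => [:: Gate1 (name_mx g) w]
  | DCGate g c w => [:: Gate2 (controlled (name_mx g)) c w]
  | DCtrlU c r => nseq r (CtrlU c)
  | DCtrlUadj c r => nseq r (CtrlUadj c)
  | DUseF ws => [:: UseF ws]
  end.

Definition circuit_of (D : seq instr) : seq (gate R) :=
  flatten (map instr_gates D).

End Denotation.

(* A description is transmitted as a sequence of numbers; opcodes determine
   the number of arguments, hence the code is uniquely decodable. *)
Definition name_code (g : gate_name) : seq nat :=
  match g with
  | Hadamard => [:: 0]
  | PauliX => [:: 1]
  | Phase p k => [:: 2; p; k]
  end%N.

Definition instr_code (i : instr) : seq nat :=
  match i with
  | DGate g w => 0 :: name_code g ++ [:: w]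
  | DCGate g c w => 1 :: name_code g ++ [:: c; w]
  | DCtrlU c r => [:: 2; c; r]
  | DCtrlUadj c r => [:: 3; c; r]
  | DUseF ws => 4 :: size ws :: ws
  end%N.

Definition encode (D : seq instr) : seq nat := flatten (map instr_code D).

(* Classical computation: a random access machine with logarithmic cost
   (every step costs the total bit length of the numbers it handles), addition
   and truncated subtraction as arithmetic, indirect addressing, structured
   control flow and a write-only output. *)
Inductive ram :=
| RSet of nat & nat          (* M[x] := c *)
| RAdd of nat & nat & nat    (* M[x] := M[y] + M[z] *)
| RSub of nat & nat & nat    (* M[x] := M[y] - M[z] *)
| RLoad of nat & nat         (* M[x] := M[M[y]] *)
| RStore of nat & nat        (* M[M[x]] := M[y] *)
| REmit of nat               (* output M[x] *)
| RSeq of ram & ram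
| RWhile of nat & ram.       (* while M[x] <> 0 *)

Definition bitlen (n : nat) : nat := (trunc_log 2 n).+1.

Definition memory := nat -> nat.

Definition upd (M : memory) (x v : nat) : memory := [eta M with x |-> v].

Inductive exec : ram -> memory * seq nat -> memory * seq nat -> nat -> Prop :=
| ExecSet x c M o :
    exec (RSet x c) (M, o) (upd M x c, o) (bitlen c)
| ExecAdd x y z M o :
    exec (RAdd x y z) (M, o) (upd M x (M y + M z), o)
         (bitlen (M y) + bitlen (M z))
| ExecSub x y z M o :
    exec (RSub x y z) (M, o) (upd M x (M y - M z), o)
         (bitlen (M y) + bitlen (M z))
| ExecLoad x y M o :
    exec (RLoad x y) (M, o) (upd M x (M (M y)), o)
         (bitlen (M y) + bitlen (M (M y)))
| ExecStore x y M o :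
    exec (RStore x y) (M, o) (upd M (M x) (M y), o)
         (bitlen (M x) + bitlen (M y))
| ExecEmit x M o :
    exec (REmit x) (M, o) (M, rcons o (M x)) (bitlen (M x))
| ExecSeq p q s1 s2 s3 t u :
    exec p s1 s2 t -> exec q s2 s3 u -> exec (RSeq p q) s1 s3 (t + u)
| ExecWhileStop x p M o :
    M x = 0%N -> exec (RWhile x p) (M, o) (M, o) (bitlen (M x))
| ExecWhileStep x p M o s2 s3 t u :
    M x <> 0%N -> exec p (M, o) s2 t -> exec (RWhile x p) s2 s3 u ->
    exec (RWhile x p) (M, o) s3 (bitlen (M x) + t + u).

(* On input m (in cell 0, all other cells being 0), p halts after time t
   with output out. *)
Definition computes (p : ram) (m : nat) (out : seq nat) (t : nat) : Prop :=
  exists M : memory, exec p (upd (fun=> 0%N) 0 m, [::]) (M, out) t.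

(* Main.v *)
(* Put N = 4 * d = 2 ^ M. For an eigenvalue z of U, the circuit prepares a state
    phi on M qubits, multiplies |j> by z ^ j with the controlled powers of U,
    goes to the Fourier basis, applies f at the N-th roots of unity, and undoes
    the same steps for a state psi. The resulting amplitude is linear in f. With
    phi uniform on [d, 3d) and psi uniform on [0, 4d), the cross-correlation of
    phi and psi equals 1 / sqrt 2 on [-d, d] and vanishes from distance 3d on, so
    aliasing modulo 4d does no harm: sqrt 2 times the amplitude of a Laurent
    polynomial g of degree d is g(z). By unitarity the amplitude of f - g is at
    most the supremum of |f - g|, hence the error
    |f(z) - sqrt 2 * amplitude f| <= (1 + sqrt 2) * sup |f - g|. *)
Require Import Defs.
From mathcomp Require Import all_boot all_order all_algebra.
From mathcomp Require Import mxtens complex.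
From mathcomp Require Import all_classical all_reals all_analysis.
From mathcomp Require Import ring lra zify.

Set Implicit Arguments.
Unset Strict Implicit.
Unset Printing Implicit Defensive.

Import Order.TTheory GRing.Theory Num.Theory.
Local Open Scope ring_scope.
Local Open Scope complex_scope.
Local Open Scope sesquilinear_scope.
Local Open Scope ring_scope.

(** * Basis states and their bits *)

(** The factor [sqrt 2] comes from the finite range of labels. A window that may be shifted by up to
    d either way without leaving the 4d labels has only 2d points, and uniform states on 2d and on
    4d points, one support inside the other, overlap by sqrt(2d / 4d), whatever the shift. The
    ancilla beyond the M label qubits is the flag of [F]. No other gate touches it, so [F] enters
    the amplitude only through its block with flag 0. The passage to one eigenvalue rests on a
    reduction: next to a common eigenvector of U and its adjoint, each gate becomes a matrix on the
    ancillas alone, in which the controlled black boxes are diagonal phases. The ancilla block and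
    f(U) are thus diagonal in the same orthonormal basis, and the error is controlled eigenvalue by
    eigenvalue. The Fourier transform is run without its final swaps; the order of the wires given
    to [F] absorbs the bit reversal. On the classical side every number stays below [2 ^ L], L = M +
    3, and the loops take O(M^2) steps, each of logarithmic cost O(L). *)

Definition bitsum (N : nat) (b : nat -> bool) : nat :=
  (\sum_(i < N) b i * 2 ^ (N - i.+1))%N.

(** Has the shape of the body of [subket], so that its properties transfer to [subket] by
    conversion. *)
Definition ofbits (N : nat) (b : nat -> bool) : 'I_(2 ^ N) :=
  insubd (ket0 N) (bitsum N b).

Lemma bitsumS N b : bitsum N.+1 b = (bitsum N b * 2 + b N)%N.
Proof.
rewrite /bitsum big_ord_recr /= subnn muln1; congr addn.
rewrite big_distrl; apply: eq_bigr => i _ /=.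
by rewrite subSn // expnS mulnAC -mulnA; congr muln.
Qed.

Lemma bitsum_lt N b : (bitsum N b < 2 ^ N)%N.
Proof.
elim: N => [|N IH]; first by rewrite /bitsum big_ord0.
rewrite bitsumS expnS; move: IH; case: (b N) => /=; lia.
Qed.

Lemma val_ofbits N b : val (ofbits N b) = bitsum N b.
Proof. by rewrite val_insubd bitsum_lt. Qed.

Lemma eq_bitsum N b b' :
  (forall w, (w < N)%N -> b w = b' w) -> bitsum N b = bitsum N b'.
Proof. by move=> eb; apply: eq_bigr => i _; rewrite eb. Qed.

Lemma eq_ofbits N b b' :
  (forall w, (w < N)%N -> b w = b' w) -> ofbits N b = ofbits N b'.
Proof. by move=> eb; rewrite /ofbits (eq_bitsum eb). Qed.

Lemma bitS N x w : (w < N)%N -> bit N.+1 x w = bit N (x %/ 2) w.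
Proof. by move=> wN; rewrite /bit -divnMA -expnS subSS subnSK. Qed.

Lemma bit_bitsum N b w : (w < N)%N -> bit N (bitsum N b) w = b w.
Proof.
elim: N b => // N IH b; rewrite ltnS leq_eqVlt bitsumS => /orP[/eqP ->|wN].
  by rewrite /bit subnn divn1 oddD muln2 odd_double /=; case: (b N).
rewrite bitS // divnMDl // [(b N %/ 2)%N]divn_small ?addn0 ?IH //.
by case: (b N).
Qed.

Lemma bit_ofbits N b w : (w < N)%N -> bit N (ofbits N b) w = b w.
Proof. by move=> wN; rewrite -[LHS]/(bit N (val _) w) val_ofbits bit_bitsum. Qed.

Lemma bitsum_bit N x : (x < 2 ^ N)%N -> bitsum N (bit N x) = x.
Proof.
elim: N x => [|N IH] x; first by rewrite ltnS leqn0 /bitsum big_ord0 => /eqP.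
rewrite expnS => xN; rewrite bitsumS.
have -> : bit N.+1 x N = odd x by rewrite /bit subnn divn1.
rewrite (@eq_bitsum _ _ (bit N (x %/ 2))); last by move=> w; apply: bitS.
rewrite IH; last by rewrite ltn_divLR // mulnC.
by rewrite divn2 muln2 addnC odd_double_half.
Qed.

Lemma ofbits_bit N (x : 'I_(2 ^ N)) : ofbits N (bit N x) = x.
Proof. by apply: val_inj; rewrite val_ofbits bitsum_bit. Qed.

Lemma eq_bits N (x y : 'I_(2 ^ N)) :
  (forall w, (w < N)%N -> bit N x w = bit N y w) -> x = y.
Proof. by move=> /eq_ofbits; rewrite !ofbits_bit. Qed.

Lemma bit0 N w : bit N 0 w = false.
Proof. by rewrite /bit div0n. Qed.

Lemma bit_ketD k l (i : 'I_(2 ^ k)) (j : 'I_(2 ^ l)) w : (w < k + l)%N ->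
  bit (k + l) (ketD i j) w = if (w < k)%N then bit k i w else bit l j (w - k).
Proof.
move=> wkl; rewrite /bit /=; case: ltnP => wk.
  have -> : (k + l - w.+1 = l + (k - w.+1))%N by lia.
  by rewrite expnD divnMA divnMDl ?expn_gt0 // [(j %/ 2 ^ l)%N]divn_small ?addn0.
have -> : (k + l - w.+1 = l - (w - k).+1)%N by lia.
move: (nat_of_ord i) (nat_of_ord j) => a b.
have -> : (2 ^ l = 2 ^ (w - k).+1 * 2 ^ (l - (w - k).+1))%N.
  by rewrite -expnD; congr expn; lia.
by rewrite mulnA divnMDl ?expn_gt0 // oddD oddM expnS oddM /= andbF.
Qed.

Lemma ketD_inj k l (i i' : 'I_(2 ^ k)) (j j' : 'I_(2 ^ l)) :
  ketD i j = ketD i' j' -> i = i' /\ j = j'.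
Proof.
by move=> /cast_ord_inj /(can_inj (@mxtens_indexK _ _)) [-> ->].
Qed.

Lemma sum_ketD (V : nmodType) k l (F : 'I_(2 ^ (k + l)) -> V) :
  \sum_x F x = \sum_i \sum_j F (ketD i j).
Proof.
rewrite pair_bigA /= (reindex (fun p : 'I_(2 ^ k) * 'I_(2 ^ l) => ketD p.1 p.2)) //.
exists (fun x => mxtens_unindex (cast_ord (expnD 2 k l) x)) => [[i j] _|x _].
  by rewrite /ketD cast_ordKV mxtens_indexK.
by rewrite /ketD -surjective_pairing mxtens_unindexK cast_ordK.
Qed.

(** * Gates acting on some of the wires *)

Definition agree_off N (ws : seq nat) (x y : nat) : bool :=
  [forall w : 'I_N, (val w \in ws) || (bit N x w == bit N y w)].

Lemma agree_offP N ws x y :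
  reflect (forall w, (w < N)%N -> w \notin ws -> bit N x w = bit N y w)
    (agree_off N ws x y).
Proof.
apply: (iffP forallP) => h w => [wN wws|].
  by have := h (Ordinal wN); rewrite /= (negPf wws) => /eqP.
by case: (boolP (_ \in _)) => //= /(h _ (ltn_ord w)) ->.
Qed.

Lemma agree_offC N ws x y : agree_off N ws x y = agree_off N ws y x.
Proof. by apply: eq_forallb => w; rewrite eq_sym. Qed.

Lemma bit_subket N k ws (x : 'I_(2 ^ N)) i : (i < k)%N ->
  bit k (subket k ws x) i = bit N x (nth 0 ws i)%N.
Proof. exact: (@bit_ofbits k (fun i => bit N x (nth 0 ws i)%N)). Qed.

Lemma val_subket N k ws (x : 'I_(2 ^ N)) :
  subket k ws x = bitsum k (fun i => bit N x (nth 0 ws i)%N) :> nat.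
Proof. exact: val_ofbits. Qed.

Definition put N k (ws : seq nat) (u : 'I_(2 ^ k)) (x : 'I_(2 ^ N)) :=
  ofbits N (fun w => if w \in ws then bit k u (index w ws) else bit N x w).

Lemma put_subket N k ws (x y : 'I_(2 ^ N)) : size ws = k ->
  agree_off N ws x y -> put ws (subket k ws y) x = y.
Proof.
move=> <- /agree_offP xy; apply: eq_bits => w wN; rewrite bit_ofbits //.
case: ifPn => [wws|/xy -> //].
by rewrite bit_subket ?index_mem // nth_index.
Qed.

Lemma subket_put N k ws (u : 'I_(2 ^ k)) (x : 'I_(2 ^ N)) :
  size ws = k -> uniq ws -> all (fun w => w < N)%N ws ->
  subket k ws (put ws u x) = u.
Proof.
move=> sk uws /all_nthP wsN; apply: eq_bits => i ik.
rewrite bit_subket // bit_ofbits ?wsN ?sk // mem_nth ?sk //.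
by rewrite index_uniq ?sk.
Qed.

Lemma agree_off_put N k ws (u : 'I_(2 ^ k)) (x : 'I_(2 ^ N)) (y : nat) :
  agree_off N ws (put ws u x) y = agree_off N ws x y.
Proof.
by apply/agree_offP/agree_offP => h w wN wws; rewrite -h // bit_ofbits //;
  rewrite (negPf wws).
Qed.

Lemma agree_off_refl N ws x : agree_off N ws x x.
Proof. exact/agree_offP. Qed.

(** The states that agree with x off [ws] are parametrised by their local state on [ws]. This turns
    the sum in a product of two local gates into the sum of the product of two small matrices. *)
Lemma sum_agree_off (V : nmodType) N k ws (x : 'I_(2 ^ N)) (F : 'I_(2 ^ N) -> V) :
  size ws = k -> uniq ws -> all (fun w => w < N)%N ws ->
  \sum_(y : 'I_(2 ^ N) | agree_off N ws x y) F y = \sum_(u : 'I_(2 ^ k)) F (put ws u x).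
Proof.
move=> sk uws wsN; rewrite (reindex_onto (fun u => put ws u x) (subket k ws)) /=.
  apply: eq_bigl => u; rewrite subket_put // eqxx andbT.
  by rewrite agree_offC agree_off_put agree_off_refl.
by move=> y xy; apply: put_subket.
Qed.

Section ApplyOn.
Variable R : realType.
Implicit Types (N k : nat) (ws : seq nat).

Lemma apply_onE N k ws (G : 'M[R[i]]_(2 ^ k)) x y :
  apply_on N ws G x y =
  if agree_off N ws x y then G (subket k ws x) (subket k ws y) else 0.
Proof. by rewrite mxE. Qed.

Lemma apply_on_mul N k ws (A B : 'M[R[i]]_(2 ^ k)) :
  size ws = k -> uniq ws -> all (fun w => w < N)%N ws ->
  apply_on N ws (A *m B) = apply_on N ws A *m apply_on N ws B.
Proof.
move=> sk uws wsN; apply/matrixP => x y; rewrite apply_onE !mxE.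
under [RHS]eq_bigr do rewrite !apply_onE.
rewrite (bigID (fun z : 'I_(2 ^ N) => agree_off N ws x z)) /=.
rewrite [X in _ = _ + X]big1 ?addr0; last first.
  by move=> z /negPf ->; rewrite mul0r.
rewrite (sum_agree_off _ _ sk) //.
under [RHS]eq_bigr do
  rewrite agree_offC agree_off_put agree_off_refl subket_put // agree_off_put.
by case: ifP => // _; rewrite big1 // => u _; rewrite mulr0.
Qed.

Lemma apply_on1 N k ws : size ws = k -> apply_on N ws (1%:M : 'M[R[i]]_(2 ^ k)) = 1%:M.
Proof.
move=> sk; apply/matrixP => x y; rewrite apply_onE !mxE.
case: ifPn => [xy|]; last first.
  by case: eqP => [->|//]; rewrite agree_off_refl.
congr (nat_of_bool _)%:R; apply/eqP/eqP => [sxy|->//].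
rewrite -(put_subket sk xy) -sxy put_subket //; exact: agree_off_refl.
Qed.

Lemma apply_on_adj N k ws (G : 'M[R[i]]_(2 ^ k)) :
  (apply_on N ws G)^t* = apply_on N ws (G^t*).
Proof.
apply/matrixP => x y; rewrite apply_onE 2!mxE apply_onE agree_offC.
by case: ifP; rewrite ?conjC0 // !mxE.
Qed.

Lemma apply_on_unitary N k ws (G : 'M[R[i]]_(2 ^ k)) :
  size ws = k -> uniq ws -> all (fun w => w < N)%N ws ->
  G \is unitarymx -> apply_on N ws G \is unitarymx.
Proof.
move=> sk uws wsN /unitarymxP GG; apply/unitarymxP.
by rewrite apply_on_adj -apply_on_mul // GG apply_on1.
Qed.

Lemma subket_cons N k c ws (x : 'I_(2 ^ N)) :
  subket k.+1 (c :: ws) x =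
  cast_ord (esym (expnS 2 k))
    (mxtens_index (inord (bit N x c) : 'I_2, subket k ws x)).
Proof.
apply: val_inj => /=; rewrite inordK; last by case: bit.
rewrite !val_subket /bitsum big_ord_recl subSS subn0.
by congr addn; apply: eq_bigr => i _.
Qed.

Lemma castmx_controlledE k (G : 'M[R[i]]_(2 ^ k)) (i i' : 'I_2) (j j' : 'I_(2 ^ k)) :
  controlled G (cast_ord (esym (expnS 2 k)) (mxtens_index (i, j)))
               (cast_ord (esym (expnS 2 k)) (mxtens_index (i', j'))) =
  if i == i' then if i == 1 then G j j' else (j == j')%:R else 0.
Proof.
rewrite castmxE !cast_ordK !mxE !mxtens_indexK /=.
by case: i => [[|[|//]] ?]; case: i' => [[|[|//]] ?];
  rewrite /= ?mul0r ?mul1r ?addr0 ?add0r.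
Qed.

Variant controlled_index_spec k : 'I_(2 ^ k.+1) -> Type :=
  ControlledIndex (i : 'I_2) (j : 'I_(2 ^ k)) :
    controlled_index_spec (cast_ord (esym (expnS 2 k)) (mxtens_index (i, j))).

Lemma controlled_indexP k (x : 'I_(2 ^ k.+1)) : controlled_index_spec x.
Proof.
have -> : x = cast_ord (esym (expnS 2 k))
    (mxtens_index (mxtens_unindex (cast_ord (expnS 2 k) x))).
  by rewrite mxtens_unindexK cast_ordK.
by case: mxtens_unindex => i j.
Qed.

Lemma controlled_index_eq k (i i' : 'I_2) (j j' : 'I_(2 ^ k)) :
  (cast_ord (esym (expnS 2 k)) (mxtens_index (i, j)) ==
   cast_ord (esym (expnS 2 k)) (mxtens_index (i', j'))) =
  (i == i') && (j == j').
Proof.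
by rewrite (inj_eq (@cast_ord_inj _ _ _)) (can_eq (@mxtens_indexK _ _)).
Qed.

Lemma controlledE N k c ws (G : 'M[R[i]]_(2 ^ k)) (x y : 'I_(2 ^ N)) :
  controlled G (subket k.+1 (c :: ws) x) (subket k.+1 (c :: ws) y) =
  if bit N x c == bit N y c then
    if bit N x c then G (subket k ws x) (subket k ws y)
    else (subket k ws x == subket k ws y)%:R
  else 0.
Proof.
rewrite !subket_cons castmx_controlledE -!val_eqE /= !inordK; try by case: bit.
by case: bit; case: bit.
Qed.

Lemma controlled_adj k (G : 'M[R[i]]_(2 ^ k)) :
  (controlled G)^t* = controlled (G^t*).
Proof.
apply/matrixP => x y; rewrite 2!mxE.
case: (controlled_indexP x) => i j; case: (controlled_indexP y) => i2 j2.
rewrite !castmx_controlledE [i2 == i]eq_sym.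
case: eqP => [->|_]; last by rewrite conjC0.
by case: ifP => _; rewrite ?conjC_nat 1?eq_sym // !mxE.
Qed.

Lemma controlled_mul k (A B : 'M[R[i]]_(2 ^ k)) :
  controlled A *m controlled B = controlled (A *m B).
Proof.
apply/matrixP => x y; rewrite mxE.
case: (controlled_indexP x) => i j; case: (controlled_indexP y) => i2 j2.
rewrite castmx_controlledE.
rewrite (reindex (fun p : 'I_2 * 'I_(2 ^ k) =>
    cast_ord (esym (expnS 2 k)) (mxtens_index p))) /=; last first.
  exists (fun z => mxtens_unindex (cast_ord (expnS 2 k) z)) => [p _|z _].
    by rewrite cast_ordKV mxtens_indexK.
  by rewrite mxtens_unindexK cast_ordK.
rewrite (eq_bigr (fun p => (if i == p.1 then if i == 1 then A j p.2
  else (j == p.2)%:R else 0) * (if p.1 == i2 then if p.1 == 1 then B p.2 j2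
  else (p.2 == j2)%:R else 0))); last first.
  by case=> a b _; rewrite !castmx_controlledE.
rewrite -(pair_bigA _ (fun a b => (if i == a then if i == 1 then A j b
  else (j == b)%:R else 0) * (if a == i2 then if a == 1 then B b j2
  else (b == j2)%:R else 0))) /=.
rewrite (bigD1 i) //= [X in _ + X]big1 ?addr0; last first.
  by move=> a /negPf ai; apply: big1 => b _; rewrite eq_sym ai mul0r.
rewrite eqxx; case: (i =P i2) => _; last by rewrite big1 // => b _; rewrite mulr0.
case: (i =P 1) => _; first by rewrite mxE.
rewrite (bigD1 j) //= eqxx mul1r big1 ?addr0 // => b /negPf bj.
by rewrite eq_sym bj mul0r.
Qed.

Lemma controlled1 k : controlled (1%:M : 'M[R[i]]_(2 ^ k)) = 1%:M.
Proof.
apply/matrixP => x y; rewrite [RHS]mxE.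
case: (controlled_indexP x) => i j; case: (controlled_indexP y) => i2 j2.
rewrite castmx_controlledE controlled_index_eq mxE.
by case: eqP => //= _; case: eqP.
Qed.

Lemma controlled_unitary k (G : 'M[R[i]]_(2 ^ k)) :
  G \is unitarymx -> controlled G \is unitarymx.
Proof.
move=> /unitarymxP GG; apply/unitarymxP.
by rewrite controlled_adj controlled_mul GG controlled1.
Qed.

End ApplyOn.
(** * Roots of unity and elementary gates *)

Section Expi.
Variable R : realType.
Implicit Types s t : R.

Lemma expiD s t : expi (s + t) = expi s * expi t.
Proof.
by rewrite /expi sinD cosD [LHS]/= -[RHS]/(_ +i* _)%C [cos s * sin t + _]addrC.
Qed.

Lemma expi0 : expi 0 = 1 :> R[i].
Proof. by rewrite /expi cos0 sin0. Qed.

Lemma expiN t : expi (- t) = Num.conj (expi t).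
Proof. by rewrite /expi cosN sinN. Qed.

Lemma expi_conj t : expi t * Num.conj (expi t) = 1.
Proof. by rewrite -expiN -expiD subrr expi0. Qed.

Lemma expiX t n : expi t ^+ n = expi (t * n%:R).
Proof.
elim: n => [|n IH]; first by rewrite mulr0 expi0.
by rewrite exprS IH -expiD -[n.+1]add1n natrD mulrDr mulr1.
Qed.

Lemma expi2pi : expi (2 * pi) = 1 :> R[i].
Proof. by rewrite mulr_natl /expi cos2pi sin2pi. Qed.

Lemma expipi : expi pi = -1 :> R[i].
Proof. by rewrite /expi cospi sinpi -[1 in RHS]/(1 +i* 0); simpc. Qed.

Lemma expi_half : expi (2 * pi / 2) = -1 :> R[i].
Proof. by rewrite [2 * pi]mulrC mulfK ?pnatr_eq0 // expipi. Qed.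

End Expi.

Section Names.
Variable R : realType.

Lemma sum_qubit (V : nmodType) (F : 'I_(2 ^ 1) -> V) :
  \sum_x F x = F (0 : 'I_2) + F (1 : 'I_2).
Proof.
have h (G : 'I_2 -> V) : \sum_x G x = G 0 + G 1.
  by rewrite !big_ord_recl big_ord0 addr0; congr (_ + G _); apply: val_inj.
exact: h.
Qed.

Lemma qubitP (P : 'I_(2 ^ 1) -> Prop) :
  P (0 : 'I_2) -> P (1 : 'I_2) -> forall x, P x.
Proof.
move=> P0 P1 [[|[|//]] h]; [move: P0|move: P1]; congr P; exact: val_inj.
Qed.

(** By periodicity the phase -p / 2^k equals (2^k - p) / 2^k, which keeps numerators natural;
    [name_ok] rules out truncation in the subtraction. *)
Definition adj_name (g : gate_name) : gate_name :=
  if g is Phase p k then Phase (2 ^ k - p) k else g.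

Definition name_ok (g : gate_name) : bool :=
  if g is Phase p k then (p <= 2 ^ k)%N else true.

Lemma adj_name_mx g : name_ok g -> (name_mx R g)^t* = name_mx R (adj_name g).
Proof.
case: g => [||p k] /= pk; apply/matrixP => x y; rewrite !mxE.
- by rewrite mulnC -[RHS]conjc_real.
- by rewrite conjC_nat eq_sym.
rewrite eq_sym; case: eqP => [->|_]; last by rewrite conjC0.
rewrite -expiN; case: (nat_of_ord y) => [|n]; first by rewrite !mul0r oppr0.
rewrite natrB // mulrBr mulrBl mulfK ?pnatr_eq0 ?expn_eq0 //.
by rewrite mulrBr expiD mulrC [_ * (2 * pi)]mulrC -expiX expi2pi expr1n mul1r.
Qed.

Lemma sqrt2V_sqr : (Num.sqrt 2)^-1 * (Num.sqrt 2)^-1 = 2^-1 :> R.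
Proof. by rewrite -invfM -expr2 sqr_sqrtr // ler0n. Qed.

Lemma name_mx_unitary g : name_mx R g \is unitarymx.
Proof.
have sq := sqrt2V_sqr.
have conjR (x : R) : Num.conj x%:C = x%:C := conjc_real x.
apply/unitarymxP; apply/matrixP; case: g => [||p k];
  do 2 (apply: qubitP); rewrite !mxE sum_qubit !mxE //=;
  rewrite ?(mulr0, mul0r, addr0, add0r, conjC0, expi_conj) //;
  try (by rewrite conjC1 mulr1).
all: rewrite (_ : (1 %% 2 = 1)%N) // !(muln0, mul0n, muln1, expr0, expr1).
all: rewrite !conjR -!rmorphM -rmorphD /=; apply: (congr1 (fun r => r%:C)).
all: by rewrite ?mulrN1 ?mulr1 ?mulrNN ?mulrN ?mulNr sq ?subrr ?addrN ?addNr //; lra.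
Qed.

End Names.

(** * Action of a circuit on an eigenvector of the black box *)

Section Weights.
Variable R : realType.
Implicit Types (a n k : nat) (z : R[i]).

Definition phase_mx a c z : 'M[R[i]]_(2 ^ a) :=
  diag_mx (\row_x if bit a x c then z else 1).

(* What gate_mx becomes on (ancillas) (x) v, for U v = z v. *)
Definition gate_wt a k z (F : 'M[R[i]]_(2 ^ k)) (g : gate R) :
    'M[R[i]]_(2 ^ a) :=
  match g with
  | Gate1 A w => apply_on a [:: w] A
  | Gate2 A w w' => apply_on a [:: w; w'] A
  | CtrlU c => phase_mx a c z
  | CtrlUadj c => phase_mx a c (Num.conj z)
  | UseF ws => apply_on a ws F
  end.

Definition circuit_wt a k z (F : 'M[R[i]]_(2 ^ k)) (C : seq (gate R)) :=
  foldl (fun M g => gate_wt a z F g *m M) 1%:M C.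

Definition on_ancillas a (g : gate R) : bool :=
  match g with
  | Gate1 _ w | CtrlU w | CtrlUadj w => w < a
  | Gate2 _ w w' => (w < a) && (w' < a)
  | UseF ws => all (fun w => w < a) ws
  end%N.

Lemma foldl_mulmx (T : Type) p (h : T -> 'M[R[i]]_p) (M : 'M[R[i]]_p) (s : seq T) :
  foldl (fun M g => h g *m M) M s = foldl (fun M g => h g *m M) 1%:M s *m M.
Proof.
elim: s M => [|g s IH] M /=; first by rewrite mul1mx.
by rewrite IH [in RHS]IH mulmx1 mulmxA.
Qed.

Lemma circuit_mx_cat a n k (U : 'M[R[i]]_(2 ^ n)) (F : 'M[R[i]]_(2 ^ k)) C C' :
  circuit_mx a U F (C ++ C') = circuit_mx a U F C' *m circuit_mx a U F C.
Proof. by rewrite /circuit_mx foldl_cat foldl_mulmx. Qed.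

Lemma circuit_wt_cat a k z (F : 'M[R[i]]_(2 ^ k)) C C' :
  circuit_wt a z F (C ++ C') = circuit_wt a z F C' *m circuit_wt a z F C.
Proof. by rewrite /circuit_wt foldl_cat foldl_mulmx. Qed.

Lemma circuit_wt1 a k z (F : 'M[R[i]]_(2 ^ k)) g :
  circuit_wt a z F [:: g] = gate_wt a z F g.
Proof. exact: mulmx1. Qed.

(** Each block of W, an operator on the system, has v as eigenvector, and w collects the
    eigenvalues. The relation is multiplicative, so circuits are handled gate by gate. *)
Definition sector a n (v : 'cV[R[i]]_(2 ^ n)) (W : 'M[R[i]]_(2 ^ (a + n)))
    (w : 'M[R[i]]_(2 ^ a)) : Prop :=
  forall x i y, \sum_j W (ketD x i) (ketD y j) * v j 0 = w x y * v i 0.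

Lemma sector_mul a n (v : 'cV[R[i]]_(2 ^ n)) (W W' : 'M[R[i]]_(2 ^ (a + n))) w w' :
  sector v W w -> sector v W' w' -> sector v (W *m W') (w *m w').
Proof.
move=> Ww Ww' x i y; rewrite mxE mulr_suml.
under eq_bigr do rewrite mxE sum_ketD mulr_suml.
rewrite exchange_big /=; apply: eq_bigr => x' _.
under eq_bigr do rewrite mulr_suml.
rewrite exchange_big /= mulrAC -Ww mulr_suml; apply: eq_bigr => j' _.
by rewrite -mulrA [v _ _ * _]mulrC -Ww' mulr_sumr; apply: eq_bigr => j _; rewrite mulrA.
Qed.

Lemma sector1 a n (v : 'cV[R[i]]_(2 ^ n)) : sector (a := a) v 1%:M 1%:M.
Proof.
move=> x i y; rewrite (bigD1 i) //= big1 => [|j ji].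
  rewrite addr0 !mxE; congr ((nat_of_bool _)%:R * _).
  by apply/eqP/eqP => [/ketD_inj[]|->].
rewrite mxE; case: eqP => [/ketD_inj[_ ij]|_]; last by rewrite mul0r.
by rewrite ij eqxx in ji.
Qed.

Lemma sector_apply_on a n k (v : 'cV[R[i]]_(2 ^ n)) ws (G : 'M[R[i]]_(2 ^ k)) :
  size ws = k -> all (fun w => w < a)%N ws ->
  sector v (apply_on (a + n) ws G) (apply_on a ws G).
Proof.
move=> sk /allP wsa x i y.
have bitl (u : 'I_(2 ^ a)) (j : 'I_(2 ^ n)) w : (w < a)%N ->
    bit (a + n) (ketD u j) w = bit a u w.
  by move=> wa; rewrite bit_ketD ?wa // ltn_addr.
have sub (u : 'I_(2 ^ a)) (j : 'I_(2 ^ n)) :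
    subket k ws (ketD u j) = subket k ws u.
  by apply: eq_bits => w wk; rewrite !bit_subket // bitl // wsa // mem_nth // sk.
rewrite (bigD1 i) //= [X in _ + X]big1 ?addr0 => [|j ji]; rewrite apply_onE.
  rewrite apply_onE !sub.
  suff -> : agree_off (a + n) ws (ketD x i) (ketD y i) = agree_off a ws x y by [].
  apply/agree_offP/agree_offP => h w wN wws.
    by rewrite -(bitl _ i) // -(bitl _ i) // h // ltn_addr.
  by rewrite !bit_ketD //; case: ifP => // wa; rewrite h.
case: agree_offP => [h|_]; last by rewrite mul0r.
case/eqP: ji; apply: eq_bits => w wn; have := h (a + w)%N.
rewrite !bit_ketD ?ltn_add2l // [(a + w < a)%N]ltnNge leq_addr /= addKn => -> //.
by apply/negP => /wsa; rewrite ltnNge leq_addr.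
Qed.

Lemma sector_controlled a n (v : 'cV[R[i]]_(2 ^ n)) c (U : 'M[R[i]]_(2 ^ n)) z :
  (c < a)%N -> U *m v = z *: v ->
  sector v (apply_on (a + n) (c :: iota a n) (controlled U)) (phase_mx a c z).
Proof.
move=> ca Uv x i y.
have bitc (u : 'I_(2 ^ a)) (j : 'I_(2 ^ n)) : bit (a + n) (ketD u j) c = bit a u c.
  by rewrite bit_ketD ?ca // ltn_addr.
have sub (u : 'I_(2 ^ a)) (j : 'I_(2 ^ n)) : subket n (iota a n) (ketD u j) = j.
  apply: eq_bits => w wn; rewrite bit_subket // nth_iota // bit_ketD ?ltn_add2l //.
  by rewrite [(a + w < a)%N]ltnNge leq_addr addKn.
under eq_bigr do rewrite apply_onE controlledE !bitc !sub.
(* The gate acts on all system wires, so agreement elsewhere constrains only the ancillas other than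
   c. *)
have off (j : 'I_(2 ^ n)) : agree_off (a + n) (c :: iota a n) (ketD x i) (ketD y j) =
    [forall w : 'I_a, (val w == c) || (bit a x w == bit a y w)].
  apply/agree_offP/forallP => [h w|h w wN].
    case: eqP => //= /eqP wc; have wN : (w < a + n)%N by rewrite ltn_addr.
    have := h w wN; rewrite !bit_ketD // ltn_ord => -> //.
    by rewrite inE negb_or wc mem_iota negb_and -ltnNge ltn_ord.
  rewrite inE mem_iota wN andbT negb_or -ltnNge => /andP[wc wa].
  by have := h (Ordinal wa); rewrite /= (negPf wc) !bit_ketD // wa => /eqP.
under eq_bigr do rewrite off.
rewrite !mxE; case: (x =P y) => [<-|xy].
  rewrite (_ : [forall w, _]); last by apply/forallP => w; rewrite eqxx orbT.
  rewrite eqxx mulr1n; case: ifP => _.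
    by have := congr1 (fun u : 'cV[R[i]]_(2 ^ n) => u i 0) Uv; rewrite !mxE.
  rewrite (bigD1 i) //= eqxx big1 ?addr0 // => j /negPf ji.
  by rewrite eq_sym ji mul0r.
rewrite mulr0n mul0r big1 // => j _; case: ifP => [/forallP h|]; last by rewrite mul0r.
case: eqP => [xyc|_]; last by rewrite mul0r.
case: xy; apply: eq_bits => w wa; have := h (Ordinal wa).
by rewrite /=; case: eqP => [->//|_] /= /eqP.
Qed.

Lemma sector_circuit a n k (v : 'cV[R[i]]_(2 ^ n)) (U : 'M[R[i]]_(2 ^ n))
    (F : 'M[R[i]]_(2 ^ k)) z C :
  U *m v = z *: v -> U^t* *m v = Num.conj z *: v ->
  circuit_wf a n k C -> all (on_ancillas a) C ->
  sector v (circuit_mx a U F C) (circuit_wt a z F C).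
Proof.
move=> Uv Uv'; elim/last_ind: C => [|C g IH] wf; first by move=> _; apply: sector1.
rewrite all_rcons -cats1 circuit_mx_cat circuit_wt_cat circuit_wt1 => /andP[ga Ca].
apply: sector_mul; last first.
  apply: IH => // i iC; have := wf i; rewrite size_rcons nth_rcons iC; apply.
  exact: ltnW.
have {wf} : gate_wf a n k g.
  by have := wf (size C); rewrite size_rcons nth_rcons ltnn eqxx; apply.
rewrite /circuit_mx /= mulmx1.
case: g ga => [A w|A w w'|c|c|ws] /= ga.
- by move=> _; apply: sector_apply_on; rewrite //= ga.
- by move=> _; apply: sector_apply_on; rewrite //= andbT.
- by move=> _; apply: sector_controlled.
- by move=> _; apply: sector_controlled.
- by case=> sws uws _; apply: sector_apply_on.
Qed.

Lemma phase_mx_adj a c z : (phase_mx a c z)^t* = phase_mx a c (Num.conj z).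
Proof.
rewrite /phase_mx tr_diag_mx map_diag_mx; congr diag_mx.
by apply/rowP => x; rewrite !mxE; case: ifP => _ //; apply: conjC1.
Qed.

Lemma phase_mx_unitary a c z : z * Num.conj z = 1 -> phase_mx a c z \is unitarymx.
Proof.
move=> zz; apply/unitarymxP; rewrite phase_mx_adj mulmx_diag -diag_const_mx.
congr diag_mx; apply/rowP => x; rewrite !mxE.
by case: ifP => _; rewrite ?mulr1.
Qed.

(** The reduced circuit has no system wires left, hence well-formedness with 0 system qubits. *)
Lemma gate_wt_unitary a k z (F : 'M[R[i]]_(2 ^ k)) g :
  z * Num.conj z = 1 -> F \is unitarymx -> on_ancillas a g ->
  gate_wf a 0 k g -> gate_wt a z F g \is unitarymx.
Proof.
move=> zz FF; case: g => [A w|A w w'|c|c|ws] /=.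
- by move=> wa [AA _]; apply: apply_on_unitary; rewrite //= wa.
- move=> wa [AA _ _ ww]; apply: apply_on_unitary; rewrite //= ?inE ?ww //.
  by rewrite andbT.
- by move=> _ _; apply: phase_mx_unitary.
- by move=> _ _; apply: phase_mx_unitary; rewrite conjCK mulrC.
- by move=> wa [sk uw _]; apply: apply_on_unitary.
Qed.

Lemma gate_mx_unitary a n k (U : 'M[R[i]]_(2 ^ n)) (F : 'M[R[i]]_(2 ^ k)) g :
  U \is unitarymx -> F \is unitarymx -> 
  gate_wf a n k g -> gate_mx a U F g \is unitarymx.
Proof.
move=> UU FF.
have ctl c (V : 'M[R[i]]_(2 ^ n)) : V \is unitarymx -> (c < a)%N ->
    apply_on (a + n) (c :: iota a n) (controlled V) \is unitarymx.
  move=> VV ca; apply: apply_on_unitary; rewrite /= ?size_iota ?iota_uniq ?andbT //.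
  - by rewrite mem_iota leqNgt ca.
  - rewrite ltn_addr //; apply/allP => w; rewrite mem_iota.
    by case/andP.
  - exact: controlled_unitary.
case: g => [A w|A w w'|c|c|ws] /=.
- by case=> AA wa; apply: apply_on_unitary; rewrite //= wa.
- move=> [AA wa wa' ww]; apply: apply_on_unitary; rewrite //= ?inE ?ww //.
  by rewrite wa wa'.
- exact: ctl.
- by apply: ctl; rewrite trmxC_unitary.
- by move=> [sk uw aw]; apply: apply_on_unitary.
Qed.

Lemma circuit_mx_unitary a n k (U : 'M[R[i]]_(2 ^ n)) (F : 'M[R[i]]_(2 ^ k)) C :
  U \is unitarymx -> F \is unitarymx -> 
  circuit_wf a n k C -> circuit_mx a U F C \is unitarymx.
Proof.
move=> UU FF; elim/last_ind: C => [|C g IH] wf.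
  by apply/unitarymxP; rewrite mul1mx trmx1 map_mx1.
rewrite -cats1 circuit_mx_cat; apply: mul_unitarymx; last first.
  apply: IH => i iC; have := wf i; rewrite size_rcons nth_rcons iC; apply.
  exact: ltnW.
rewrite /circuit_mx /= mulmx1; apply: gate_mx_unitary => //.
by have := wf (size C); rewrite size_rcons nth_rcons ltnn eqxx; apply.
Qed.

Lemma circuit_wt_unitary a k z (F : 'M[R[i]]_(2 ^ k)) C :
  z * Num.conj z = 1 -> F \is unitarymx -> all (on_ancillas a) C ->
  circuit_wf a 0 k C -> circuit_wt a z F C \is unitarymx.
Proof.
move=> zz FF; elim/last_ind: C => [|C g IH].
  by move=> _ _; apply/unitarymxP; rewrite mul1mx trmx1 map_mx1.
rewrite all_rcons => /andP[ga Ca] wf.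
rewrite -cats1 circuit_wt_cat; apply: mul_unitarymx; last first.
  apply: IH => // i iC; have := wf i; rewrite size_rcons nth_rcons iC; apply.
  exact: ltnW.
rewrite circuit_wt1; apply: gate_wt_unitary => //.
by have := wf (size C); rewrite size_rcons nth_rcons ltnn eqxx; apply.
Qed.

(** The gate set offers no adjoint of the black box F; only circuits free of [UseF] are reversed. *)
Definition adj_gate (g : gate R) : gate R :=
  match g with
  | Gate1 A w => Gate1 (A^t*) w
  | Gate2 A w w' => Gate2 (A^t*) w w'
  | CtrlU c => CtrlUadj c
  | CtrlUadj c => CtrlU c
  | UseF ws => UseF ws
  end.

Lemma circuit_wt_adj a k z (F : 'M[R[i]]_(2 ^ k)) C :
  ~~ has (@is_useF R) C ->
  circuit_wt a z F (rev (map adj_gate C)) = (circuit_wt a z F C)^t*.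
Proof.
elim: C => [|g C IH] /=; first by rewrite /circuit_wt /= trmx1 map_mx1.
rewrite negb_or => /andP[gF CF]; rewrite rev_cons -cats1 circuit_wt_cat IH //.
rewrite -cat1s (circuit_wt_cat _ _ _ [:: g]) trmx_mul map_mxM !circuit_wt1.
congr (_ *m _); case: g gF => //= *; rewrite ?apply_on_adj ?phase_mx_adj //.
by rewrite conjCK.
Qed.

End Weights.

(** * The circuit and its amplitudes *)

Definition hadamards (ws : seq nat) : seq instr := [seq DGate Hadamard w | w <- ws].

Definition ctrl_powers (M : nat) (ws : seq nat) : seq instr :=
  [seq DCtrlU w (2 ^ (M - w.+1)) | w <- ws].

(** With e = k - i + 1, the numerator 2^e - 1 stands for -1, so the phase is -1 / 2^e of a full
    turn. *)
Definition inv_cphase (i k : nat) : instr :=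
  DCGate (Phase (2 ^ (k - i).+1 - 1) (k - i).+1) i k.

Definition iqft_block (M i : nat) : seq instr :=
  DGate Hadamard i :: [seq inv_cphase i k | k <- iota i.+1 (M - i.+1)].

Definition iqft (M i : nat) : seq instr := flatten [seq iqft_block M j | j <- iota 0 i].

Lemma iqftS M i : iqft M i.+1 = iqft M i ++ iqft_block M i.
Proof. by rewrite /iqft -addn1 iotaD map_cat flatten_cat /= cats0. Qed.

(* Uniform superposition of the j with d <= j < 3 * d, d = 2 ^ (M - 2): these
   are the j whose two leading bits differ. *)
Definition middle_prep (M : nat) : seq instr :=
  hadamards (0 :: rev (iota 2 (M - 2))) ++
  [:: DGate PauliX 1; DCGate PauliX 0 1].

(** * Matrix entries of the gates and of the inverse Fourier transform *)

Section Kernels.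
Variables (R : realType) (a k : nat) (z : R[i]) (F : 'M[R[i]]_(2 ^ k)).
Implicit Types (x y : 'I_(2 ^ a)) (D : seq instr).

Let W D : 'M[R[i]]_(2 ^ a) := circuit_wt a z F (circuit_of R D).
Let c : R[i] := ((Num.sqrt 2)^-1)%:C.

Lemma circuit_of_cat (D D' : seq instr) :
  circuit_of R (D ++ D') = circuit_of R D ++ circuit_of R D'.
Proof. by rewrite /circuit_of map_cat flatten_cat. Qed.

Lemma instr_wt_cat D D' : W (D ++ D') = W D' *m W D.
Proof. by rewrite /W circuit_of_cat circuit_wt_cat. Qed.

Lemma instr_wt0 : W [::] = 1%:M.
Proof. by []. Qed.

Lemma agree_off_bits ws x y : agree_off a ws x y ->
  (forall w, w \in ws -> bit a x w = bit a y w) -> x = y.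
Proof.
move=> /agree_offP h hw; apply: eq_bits => w wa.
by case: (boolP (w \in ws)) => [/hw|/h ->].
Qed.

Definition setbit (w : nat) (b : bool) x : 'I_(2 ^ a) :=
  ofbits a (fun v => if v == w then b else bit a x v).

Lemma bit_setbit w b x v : (v < a)%N ->
  bit a (setbit w b x) v = if v == w then b else bit a x v.
Proof. exact: bit_ofbits. Qed.

Lemma agree_off_setbit w b x : agree_off a [:: w] x (setbit w b x).
Proof.
by apply/agree_offP => v va; rewrite inE bit_setbit // => /negPf ->.
Qed.

Lemma setbit_eq w x y : agree_off a [:: w] x y -> setbit w (bit a y w) x = y.
Proof.
move=> /agree_offP h; apply: eq_bits => v va; rewrite bit_setbit //.
by case: eqP => [->//|/eqP vw]; rewrite h // inE.
Qed.

Lemma subket1 w x : subket 1 [:: w] x = bit a x w :> nat.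
Proof. by rewrite val_subket /bitsum big_ord_recl big_ord0 addn0 muln1. Qed.

Lemma subket1_eq w x y :
  (subket 1 [:: w] x == subket 1 [:: w] y) = (bit a x w == bit a y w).
Proof.
apply/eqP/eqP => [h|h]; last by apply: val_inj; rewrite /= !subket1 h.
by have := subket1 w x; rewrite h subket1; case: bit; case: bit.
Qed.

Lemma hadamard_mxE w x y : apply_on a [:: w] (name_mx R Hadamard) x y =
  if agree_off a [:: w] x y then c * (-1) ^+ (bit a x w && bit a y w) else 0.
Proof.
rewrite apply_onE; case: ifP => // _.
by rewrite mxE !subket1 mulnb rmorphM rmorphXn rmorphN1.
Qed.

Lemma eq_setbit w b x y : (w < a)%N -> agree_off a [:: w] x y ->
  (y == setbit w b x) = (bit a y w == b).
Proof.
move=> wa xy; apply/eqP/eqP => [->|<-]; last by rewrite setbit_eq.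
by rewrite bit_setbit // eqxx.
Qed.

Lemma pauliX_mxE w x y : (w < a)%N ->
  apply_on a [:: w] (name_mx R PauliX) x y = (y == setbit w (~~ bit a x w) x)%:R.
Proof.
move=> wa; rewrite apply_onE; case: ifPn => [xy|xy]; last first.
  case: eqP => // e; move: xy; rewrite e.
  by move=> /negP[]; apply: agree_off_setbit.
rewrite mxE subket1_eq eq_setbit //.
by case: bit; case: bit.
Qed.

Lemma controlledX_mxE v w x y : (v < a)%N -> (w < a)%N -> v != w ->
  apply_on a [:: v; w] (controlled (name_mx R PauliX)) x y =
  (y == setbit w (bit a x w (+) bit a x v) x)%:R.
Proof.
move=> va wa vw; rewrite apply_onE controlledE; set y' := setbit _ _ _.
have bv : bit a y' v = bit a x v by rewrite bit_setbit // (negPf vw).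
case: ifPn => [/agree_offP xy|xy]; last first.
  case: eqP => // e; move: xy; rewrite e.
  case: agree_offP => // -[] u ua; rewrite !inE negb_or bit_setbit //.
  by case/andP=> _ /negPf ->.
case: (bit a x v =P bit a y v) => [xyv|xyv]; last first.
  by case: eqP => // e; case: xyv; rewrite e bv.
have {}xy : agree_off a [:: w] x y.
  apply/agree_offP => u ua; rewrite inE => uw; case: (u =P v) => [->//|/eqP uv].
  by rewrite xy // !inE negb_or uv.
rewrite /y' eq_setbit // mxE !subket1_eq.
by case: (bit a x v); case: (bit a x w); case: (bit a y w).
Qed.

Lemma cphase_mxE v w p e :
  apply_on a [:: v; w] (controlled (name_mx R (Phase p e))) =
  diag_mx (\row_x if bit a x v && bit a x w
                  then expi (2 * pi * p%:R / (2 ^ e)%:R) else 1).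
Proof.
apply/matrixP => x y; rewrite apply_onE controlledE !mxE !subket1_eq subket1.
case: (x =P y) => [<-|xy].
  rewrite agree_off_refl !eqxx mulr1n -/(bit a x v).
  by case: bit => //=; case: bit; rewrite ?mul1r // mul0r expi0.
rewrite mulr0n; case: ifP => // hxy; case: eqP => // xyv.
have /eqP/negPf -> : bit a x w <> bit a y w; last by rewrite if_same.
by move=> xyw; case: xy; apply: (agree_off_bits hxy) => u;
  rewrite !inE => /orP[] /eqP ->.
Qed.

(** Pauli X and its controlled version are permutation matrices: multiplying by them on the left
    only renames rows. *)
Lemma mulmx_selector p (A : 'M[R[i]]_(2 ^ a)) (f : 'I_(2 ^ a) -> 'I_(2 ^ a))
    (B : 'M[R[i]]_(2 ^ a, p)) x j :
  (forall y, A x y = (y == f x)%:R) -> (A *m B) x j = B (f x) j.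
Proof.
move=> Af; rewrite mxE (bigD1 (f x)) //= Af eqxx mul1r big1 ?addr0 // => y /negPf.
by rewrite Af => ->; rewrite mul0r.
Qed.

Lemma hadamards_col ws x : uniq ws -> all (fun w => w < a)%N ws ->
  W (hadamards ws) x (ket0 a) = c ^+ size ws * (agree_off a ws x 0)%:R.
Proof.
elim/last_ind: ws x => [|ws w IH] x.
  move=> _ _; rewrite instr_wt0 mxE mul1r; congr (nat_of_bool _)%:R.
  apply/eqP/idP => [->|xy]; first exact: agree_off_refl.
  exact: (@agree_off_bits [::] x (ket0 a)).
rewrite rcons_uniq all_rcons => /andP[wws uws] /andP[wa wsa].
rewrite /hadamards map_rcons -cats1 instr_wt_cat mxE.
(* Wire w is still in state 0 before its Hadamard gate, so a single summand survives. *)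
rewrite (bigD1 (setbit w false x)) //= big1 ?addr0 => [|y yx]; rewrite IH //.
  rewrite /W circuit_wt1 /= hadamard_mxE agree_off_setbit bit_setbit // eqxx andbF.
  rewrite mulr1 size_rcons mulrA -exprS; congr (_ * (nat_of_bool _)%:R).
  apply/agree_offP/agree_offP => h v va.
    rewrite mem_rcons inE negb_or => /andP[/negPf vw vws].
    by rewrite -(h v va vws) bit_setbit // vw.
  move=> vws; rewrite bit_setbit //; case: eqP => [_|/eqP vw]; first by rewrite bit0.
  by rewrite h // mem_rcons inE negb_or vw.
rewrite /W circuit_wt1 /= hadamard_mxE; case: ifPn => [xy|_]; last by rewrite mul0r.
case: agree_offP => [h|_]; last by rewrite !mulr0.
by case/negP: yx; rewrite eq_setbit // h // bit0.
Qed.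

(** The Hadamard gates leave wires 1 and M at 0; the X gate followed by the controlled X then sets
    bit 1 to the negation of bit 0. The proof reads these two gates backwards, from x to the state
    before them. *)
Lemma middle_prep_col M x : (1 < M)%N -> a = M.+1 ->
  W (middle_prep M) x (ket0 a) =
  c ^+ M.-1 * ((bit a x 0 != bit a x 1) && ~~ bit a x M)%:R.
Proof.
move=> M1 aM; have a1 : (1 < a)%N by rewrite aM ltnS ltnW.
have a0 : (0 < a)%N by exact: ltnW.
have Ma : (M < a)%N by rewrite aM.
have wX : W [:: DGate PauliX 1] = apply_on a [:: 1%N] (name_mx R PauliX).
  exact: circuit_wt1.
have wCX : W [:: DCGate PauliX 0 1] =
    apply_on a [:: 0; 1]%N (controlled (name_mx R PauliX)).
  exact: circuit_wt1.
rewrite /middle_prep -[[:: _; _]]cat1s !instr_wt_cat wX wCX -mulmxA.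
rewrite (mulmx_selector (f := fun x => setbit 1 (bit a x 1 (+) bit a x 0) x)); last first.
  by move=> y; apply: controlledX_mxE.
rewrite (mulmx_selector (f := fun x => setbit 1 (~~ bit a x 1) x)); last first.
  by move=> y; apply: pauliX_mxE.
rewrite hadamards_col; last 2 first.
- by rewrite /= mem_rev rev_uniq iota_uniq mem_iota.
- by rewrite /= a0; apply/allP => w; rewrite mem_rev mem_iota aM; lia.
rewrite /= size_rev size_iota; congr (c ^+ _ * (nat_of_bool _)%:R); first lia.
set y := setbit _ _ _.
have by1 : bit a y 1 = (bit a x 0 == bit a x 1).
  rewrite !bit_setbit //=; by case: bit; case: bit.
have byM : bit a y M = bit a x M.
  by rewrite !bit_setbit //; case: eqP => // e; move: M1; rewrite e.
apply/agree_offP/andP => [h|[x01 xM] v va].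
  split; first by rewrite -by1 h ?bit0 // inE mem_rev mem_iota.
  by rewrite -byM h ?bit0 // inE mem_rev mem_iota; lia.
rewrite inE mem_rev mem_iota bit0 => hv.
have [->|->] : v = 1%N \/ v = M by move: hv; rewrite aM in va; lia.
  by rewrite by1 (negPf x01).
by rewrite byM (negPf xM).
Qed.

Lemma circuit_wt_nseq r w :
  circuit_wt a z F (nseq r (CtrlU w)) = phase_mx a w (z ^+ r).
Proof.
elim: r => [|r IH].
  rewrite /circuit_wt /= /phase_mx -diag_const_mx; congr diag_mx.
  by apply/rowP => x; rewrite !mxE if_same.
rewrite -[nseq _ _]/([:: CtrlU w] ++ nseq r (CtrlU w)) circuit_wt_cat circuit_wt1 IH.
rewrite mulmx_diag; congr diag_mx; apply/rowP => x; rewrite !mxE exprSr.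
by case: ifP; rewrite // mulr1.
Qed.

Lemma ctrl_powers_wt M ws :
  W (ctrl_powers M ws) =
  diag_mx (\row_x z ^+ (\sum_(w <- ws) bit a x w * 2 ^ (M - w.+1))%N).
Proof.
elim: ws => [|w ws IH].
  rewrite instr_wt0 -diag_const_mx; congr diag_mx.
  by apply/rowP => x; rewrite !mxE big_nil.
rewrite /ctrl_powers /= -cat1s instr_wt_cat IH {1}/W /circuit_of /= cats0.
rewrite circuit_wt_nseq mulmx_diag; congr diag_mx; apply/rowP => x; rewrite !mxE.
by rewrite big_cons addnC exprD; congr (_ * _); case: bit; rewrite ?mul1n.
Qed.

Variable M : nat.
Let zeta : R[i] := expi (- (2 * pi / (2 ^ M)%:R)).

Lemma zeta_period : zeta ^+ (2 ^ M) = 1.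
Proof.
by rewrite expiX mulNr divfK ?pnatr_eq0 ?expn_eq0 // expiN expi2pi conjC1.
Qed.

(** (2^e - 1) / 2^e and -1 / 2^e differ by a full turn. *)
Lemma zeta_phase e : (e <= M)%N ->
  expi (2 * pi * (2 ^ e - 1)%:R / (2 ^ e)%:R) = zeta ^+ (2 ^ (M - e)).
Proof.
move=> eM; rewrite expiX natrB ?expn_gt0 // mulrBr mulr1 mulrBl.
have nz l : (2 ^ l)%:R != 0 :> R by rewrite pnatr_eq0 expn_eq0.
rewrite mulfK // expiD expi2pi mul1r; congr expi.
have -> : (2 ^ M)%:R = (2 ^ (M - e))%:R * (2 ^ e)%:R :> R.
  by rewrite -natrM -expnD subnK.
by field; rewrite !nz.
Qed.

Lemma zeta_half : (0 < M)%N -> zeta ^+ (2 ^ (M - 1)) = -1.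
Proof.
move=> M0; rewrite -zeta_phase // subSS subn0 mulr1; exact: expi_half.
Qed.

Lemma inv_cphases_wt i ks :
  all (fun k => i < k < M)%N ks ->
  W [seq inv_cphase i k | k <- ks] =
  diag_mx (\row_x zeta ^+ (\sum_(k <- ks)
    (bit a x i && bit a x k) * 2 ^ (M - k.+1 + i))%N).
Proof.
elim: ks => [|l ks IH] /=.
  rewrite instr_wt0 -diag_const_mx => _; congr diag_mx.
  by apply/rowP => x; rewrite !mxE big_nil.
case/andP => /andP[il lM] ksM; rewrite -cat1s instr_wt_cat IH // /W circuit_wt1 /=.
rewrite cphase_mxE mulmx_diag; congr diag_mx; apply/rowP => x; rewrite !mxE.
rewrite big_cons addnC exprD; congr (_ * _); case: andb; rewrite ?mul1n //.
by rewrite zeta_phase; [congr (_ ^+ (2 ^ _))|]; lia.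
Qed.

(** The output bit of x on wire j has weight 2^j, the input bit of y on wire k has weight 2^(M - k -
    1). Block j couples wire j only to itself and to later wires, whence j <= k. *)
Definition iqft_phase i x y : nat :=
  (\sum_(j < i) \sum_(j <= k < M) (bit a x j && bit a y k) * 2 ^ (M - k.+1 + j))%N.

(** After i blocks the wires below i hold output bits and all others still hold input bits, which
    gives the agreement condition and makes the induction go through. *)
Lemma iqft_wt i x y : (i <= M)%N -> (M <= a)%N ->
  W (iqft M i) x y =
  if agree_off a (iota 0 i) x y then c ^+ i * zeta ^+ iqft_phase i x y else 0.
Proof.
move=> + Ma; elim: i x y => [|i IH] x y iM.
  rewrite instr_wt0 mxE /iqft_phase big_ord0 mulr1.
  have -> : (x == y) = agree_off a (iota 0 0) x y; last by case: ifP.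
  apply/eqP/idP => [->|xy]; [exact: agree_off_refl|exact: (agree_off_bits xy)].
have ia : (i < a)%N by exact: leq_trans Ma.
rewrite iqftS instr_wt_cat /iqft_block -cat1s instr_wt_cat inv_cphases_wt; last first.
  by apply/allP => l; rewrite mem_iota; lia.
rewrite -mulmxA mul_diag_mx !mxE.
(* The only intermediate state that contributes: output bits below i, the input bit on wire i. *)
set w0 := setbit i (bit a y i) x.
have w0b v : (v < a)%N -> v != i -> bit a w0 v = bit a x v.
  by move=> va /negPf vi; rewrite bit_setbit // vi.
have iff : agree_off a (iota 0 i) w0 y = agree_off a (iota 0 i.+1) x y.
  apply/agree_offP/agree_offP => h v va; rewrite mem_iota /= => iv.
    have vi : v != i by lia.
    by rewrite -w0b // h // mem_iota /=; lia.
  rewrite bit_setbit //; case: eqP => [->//|/eqP vi].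
  by rewrite h // mem_iota /=; lia.
rewrite (bigD1 w0) //= [X in _ * (_ + X)]big1 ?addr0 => [|w ww0];
  rewrite IH ?(ltnW iM) //; last first.
  rewrite /W circuit_wt1 /= hadamard_mxE; case: ifPn => [xw|_]; last by rewrite mul0r.
  case: agree_offP => [h|_]; last by rewrite mulr0.
  by case/negP: ww0; rewrite eq_setbit // h // mem_iota /= ltnn.
rewrite iff; case: ifPn => [/agree_offP xy|_]; last by rewrite !mulr0.
rewrite /W circuit_wt1 /= hadamard_mxE agree_off_setbit bit_setbit // eqxx.
set S := (\sum_(l <- _) _)%N.
suff -> : zeta ^+ iqft_phase i.+1 x y = zeta ^+ S *
    ((-1) ^+ (bit a x i && bit a y i) * zeta ^+ iqft_phase i w0 y).
  by rewrite exprS; ring.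
(* The Hadamard sign is a power of [zeta] as well, and supplies the term k = i of the phase. *)
rewrite -zeta_half ?(leq_ltn_trans _ iM) // -exprM -!exprD /iqft_phase.
congr (_ ^+ _); rewrite big_ord_recr /= addnA addnC; congr addn.
  rewrite (big_ltn iM) addnC; congr addn; last first.
    by rewrite mulnC; congr (2 ^ _ * _)%N; lia.
  apply: eq_big_nat => l /andP[il lM]; rewrite (xy l) //.
    exact: leq_trans lM Ma.
  by rewrite mem_iota /= -ltnNge.
apply: eq_bigr => j _; apply: eq_bigr => l _.
by rewrite w0b ?(ltn_trans _ ia) // ltn_eqF.
Qed.

(* zeta ^+ (2 ^ M) = 1 kills the terms of the product of the two integers that
   iqft_phase leaves out. *)
Lemma iqft_phaseE x y : zeta ^+ iqft_phase M x y =
  zeta ^+ (bitsum M (fun w => bit a x (M - w.+1)) * bitsum M (bit a y)).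
Proof.
rewrite /bitsum (reindex_inj rev_ord_inj) /= big_distrl /= /iqft_phase !expr_sum.
apply: eq_bigr => j _; rewrite big_distrr /= !expr_sum.
rewrite (big_nat_widenl _ 0) // big_mkord big_mkcond.
apply: eq_bigr => l _ /=.
have -> : (M - (M - j.+1).+1 = j)%N by have := ltn_ord j; lia.
rewrite -mulnb mulnACA -expnD.
case: leqP => jl; first by rewrite addnC.
have -> : (j + (M - l.+1) = M + (j - l.+1))%N by have := ltn_ord j; lia.
by rewrite expnD mulnCA exprM zeta_period expr1n.
Qed.

End Kernels.

(** * The state after preparation, controlled powers and Fourier transform *)

Section Columns.
Variables (R : realType) (M k : nat) (z : R[i]) (F : 'M[R[i]]_(2 ^ k)).
Implicit Types (x y : 'I_(2 ^ (M + 1))) (D : seq instr).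

Let W D : 'M[R[i]]_(2 ^ (M + 1)) := circuit_wt (M + 1) z F (circuit_of R D).
Let c : R[i] := ((Num.sqrt 2)^-1)%:C.
Let zeta : R[i] := expi (- (2 * pi / (2 ^ M)%:R)).

Lemma bitsum_ketD (j : 'I_(2 ^ M)) (f : 'I_(2 ^ 1)) :
  bitsum M (bit (M + 1) (ketD j f)) = j.
Proof.
rewrite -[RHS](bitsum_bit (ltn_ord j)); apply: eq_bitsum => w wM.
by rewrite bit_ketD ?wM // ltn_addr.
Qed.

Lemma bit_ketD_last (j : 'I_(2 ^ M)) (f : 'I_(2 ^ 1)) :
  bit (M + 1) (ketD j f) M = odd f.
Proof. by rewrite bit_ketD ?addn1 // ltnn subnn /bit divn1. Qed.

(** The controlled powers are diagonal, so their order is free; a permutation [ws] is allowed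
    because the two fronts list the wires in opposite orders. *)
Lemma iqft_column D (phi : nat -> R[i]) ws y : (0 < M)%N ->
  perm_eq ws (iota 0 M) ->
  (forall x, W D x (ket0 (M + 1)) =
     (~~ bit (M + 1) x M)%:R * phi (bitsum M (bit (M + 1) x))) ->
  W (D ++ ctrl_powers M ws ++ iqft M M) y (ket0 (M + 1)) =
  (~~ bit (M + 1) y M)%:R * (c ^+ M * \sum_(j < 2 ^ M)
     zeta ^+ (bitsum M (fun w => bit (M + 1) y (M - w.+1)) * j) * (z ^+ j * phi j)).
Proof.
move=> M0 ws_perm Dphi.
rewrite /W !instr_wt_cat -!/(W _) -mulmxA mxE sum_ketD.
rewrite 2!mulr_sumr; apply: eq_bigr => j _; rewrite sum_qubit.
have cp : W (ctrl_powers M ws) = _ := ctrl_powers_wt (M + 1) z F M ws.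
have pw x : (\sum_(w <- ws) bit (M + 1) x w * 2 ^ (M - w.+1))%N =
    bitsum M (bit (M + 1) x).
  by rewrite (perm_big _ ws_perm) /bitsum -(big_mkord xpredT
    (fun w => bit (M + 1) x w * 2 ^ (M - w.+1))%N) /index_iota subn0.
rewrite cp !mul_diag_mx !mxE !pw !bitsum_ketD !Dphi !bit_ketD_last !bitsum_ketD.
rewrite /= !mul0r !mulr0 addr0 mul1r /W. rewrite iqft_wt ?leq_addr //.
have -> : agree_off (M + 1) (iota 0 M) y (@ketD M 1 j (0 : 'I_2)) =
    ~~ bit (M + 1) y M.
  apply/agree_offP/idP => [h|yM v va].
    by rewrite h ?addn1 // ?mem_iota ?ltnn // bit_ketD_last.
  rewrite mem_iota leq0n add0n -leqNgt => Mv.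
  have -> : v = M by move: va; rewrite addn1 ltnS => vM; apply/eqP; rewrite eqn_leq vM.
  by rewrite (negPf yM) bit_ketD_last.
case: ifP => _; last by rewrite !mul0r.
by rewrite !mul1r iqft_phaseE // (bitsum_ketD j (0 : 'I_2)) -mulrA.
Qed.

End Columns.

(** * Fourier analysis of the amplitude *)

Section Amplitude.
Variables (R : realType) (M : nat).
Hypothesis M0 : (0 < M)%N.
Let omega : R[i] := expi (2 * pi / (2 ^ M)%:R).
Let zeta : R[i] := expi (- (2 * pi / (2 ^ M)%:R)).

Lemma omega_zeta : omega * zeta = 1.
Proof. by rewrite -expiD subrr expi0. Qed.

Lemma omegaX l : omega ^+ l = expi (2 * pi * l%:R / (2 ^ M)%:R).
Proof. by rewrite expiX; congr expi; rewrite mulrAC. Qed.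

(** The order of [omega] divides 2^M, hence is a power of 2; a smaller one would divide 2^(M-1), but
    that power of [omega] is -1. *)
Lemma omega_prim : (2 ^ M).-primitive_root omega.
Proof.
have omegaV : omega = zeta^-1.
  by rewrite -[LHS]mulr1 -(mulfV (x := zeta)) ?mulrA ?omega_zeta ?mul1r //;
    apply: contra_eq_neq omega_zeta => ->; rewrite mulr0 eq_sym oner_neq0.
have o1 : omega ^+ (2 ^ M) = 1 by rewrite omegaV exprVn zeta_period invr1.
have [q q_prim q_dvd] := prim_order_exists (expn_gt0 2 M) o1.
have /(dvdn_pfactor _ _ (isT : prime 2))[e eM qe] := q_dvd.
move: eM; rewrite leq_eqVlt => /orP[/eqP <-|eM]; first by rewrite -qe.
have : omega ^+ (2 ^ (M - 1)) == 1.
  by rewrite -(prim_order_dvd q_prim) qe dvdn_exp2l // -ltnS subn1 prednK.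
rewrite omegaV exprVn zeta_half // invrN1 -subr_eq0 -opprD oppr_eq0.
by rewrite (pnatr_eq0 _ 2).
Qed.

Lemma character_sum k l : (k < 2 ^ M)%N -> (l < 2 ^ M)%N ->
  \sum_(t < 2 ^ M) (omega ^+ t) ^+ k * (zeta ^+ t) ^+ l =
  if k == l then (2 ^ M)%:R else 0.
Proof.
move=> kM lM.
under eq_bigr do rewrite -!exprM ![(_ * k)%N]mulnC ![(_ * l)%N]mulnC !exprM -exprMn.
set x := omega ^+ k * zeta ^+ l.
have xM : x ^+ (2 ^ M) = 1.
  by rewrite exprMn -!exprM ![(_ * 2 ^ M)%N]mulnC !exprM zeta_period
    (prim_expr_order omega_prim) !expr1n mulr1.
case: eqP => [kl|kl].
  have -> : x = 1 by rewrite /x kl -exprMn omega_zeta expr1n.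
  by under eq_bigr do rewrite expr1n; rewrite sumr_const card_ord.
have : x - 1 != 0.
  rewrite subr_eq0; apply/eqP => x1.
  have : omega ^+ k == omega ^+ l.
    rewrite -[X in _ == X]mul1r -x1 /x -mulrA -exprMn [zeta * _]mulrC.
    by rewrite omega_zeta expr1n mulr1.
  by rewrite (eq_prim_root_expr omega_prim) !modn_small // => /eqP.
by move=> /mulfI; apply; rewrite mulr0 -subrX1 xM subrr.
Qed.

Variables (z : R[i]).
Hypothesis z1 : z * Num.conj z = 1.
Let c : R[i] := ((Num.sqrt 2)^-1)%:C.

Definition uniform_amp (l : nat) : R[i] :=
  c ^+ M * \sum_(j < 2 ^ M) zeta ^+ (l * j) * (z ^+ j * c ^+ M).

Definition middle (M j : nat) : bool := bit M j 0 != bit M j 1.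

Definition middle_amp (l : nat) : R[i] :=
  c ^+ M * \sum_(j < 2 ^ M) zeta ^+ (l * j) * (z ^+ j * (c ^+ M.-1 * (middle M j)%:R)).

(* The scalar by which the ancilla block of the circuit acts on an eigenvector
   of eigenvalue z. *)
Definition amplitude (h : R[i] -> R[i]) : R[i] :=
  \sum_(l < 2 ^ M) Num.conj (uniform_amp l) * h (omega ^+ l) * middle_amp l.

Lemma conj_c : Num.conj c = c.
Proof. exact: conjc_real. Qed.

Lemma c_sqr : c * c = 2^-1.
Proof. by rewrite -rmorphM sqrt2V_sqr fmorphV rmorph_nat. Qed.

Lemma sqrt2_c : (Num.sqrt 2)%:C * c = 1 :> R[i].
Proof.
by rewrite -rmorphM mulfV ?rmorph1 // gt_eqF // sqrtr_gt0 ltr0n.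
Qed.

Lemma zeta_conj : zeta = Num.conj omega.
Proof. exact: expiN. Qed.

Lemma expfz_conj (x : R[i]) : x * Num.conj x = 1 -> Num.conj x = x^-1.
Proof.
move=> xx; have x0 : x != 0.
  by apply: contra_eq_neq xx => ->; rewrite mul0r eq_sym oner_neq0.
by apply: (mulfI x0); rewrite xx mulfV.
Qed.

(** Once the three sums are expanded, summing over the frequency l leaves only k = j + d - q, and
    the term equals z^(j - k) = z^(q - d) up to a constant. For j in the window this k lies in [0,
    4d), so all 2d values of j contribute equally. *)
Lemma amplitude_monomial q : (2 <= M)%N -> (q <= 2 * 2 ^ (M - 2))%N ->
  (Num.sqrt 2)%:C * amplitude (fun w => w ^ (q%:Z - (2 ^ (M - 2))%:Z)) =
  z ^ (q%:Z - (2 ^ (M - 2))%:Z).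
Proof.
move=> M2; set d := (2 ^ (M - 2))%N => qd.
have Nd : (2 ^ M = 4 * d)%N by rewrite -(expnD 2 2) subnKC.
have z0 : z != 0 by apply: contra_eq_neq z1 => ->; rewrite mul0r eq_sym oner_neq0.
have zV := expfz_conj z1.
have oV : zeta = omega^-1 by rewrite zeta_conj expfz_conj ?expi_conj.
have o0 : omega != 0.
  by apply: contra_eq_neq omega_zeta => ->; rewrite mul0r eq_sym oner_neq0.
(* The two leading bits of j are the bits of t = j / d < 4; they differ exactly for t = 1 and t =
   2. *)
have mid j : (j < 2 ^ M)%N -> middle M j = (d <= j < 3 * d)%N.
  move=> jN; rewrite /middle /bit -/d.
  have -> : (2 ^ (M - 1) = d * 2)%N by rewrite mulnC -expnS; congr expn; lia.
  rewrite divnMA; set t := (j %/ d)%N.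
  have d0 : (0 < d)%N by rewrite expn_gt0.
  have -> : (d <= j < 3 * d)%N = (0 < t < 3)%N by rewrite divn_gt0 // ltn_divLR.
  have : (t < 4)%N by rewrite ltn_divLR // -Nd.
  by case: t => [|[|[|[|t]]]].
rewrite /amplitude.
have term (l : 'I_(2 ^ M)) : Num.conj (uniform_amp l) *
    (omega ^+ l) ^ (q%:Z - d%:Z) * middle_amp l =
  \sum_(j < 2 ^ M) (c ^+ M * c ^+ M * c ^+ M * c ^+ M.-1) *
   \sum_(k < 2 ^ M) ((middle M j)%:R * z ^+ j * z ^- k) *
     ((omega ^+ l) ^+ k * (zeta ^+ l) ^+ (j + d - q)).
  rewrite /uniform_amp /middle_amp mulrA mulr_sumr; apply: eq_bigr => j _.
  rewrite rmorphM rmorphXn /= conj_c rmorph_sum /= !mulr_sumr !mulr_suml.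
  apply: eq_bigr => k _.
  rewrite !rmorphM !rmorphXn /= conj_c zV zeta_conj conjCK -zeta_conj oV.
  case: (boolP (middle M j)) => jm; last by rewrite !(mulr0, mul0r).
  (* Then q <= 2d <= j + d, so the natural subtraction j + d - q is not truncated. *)
  have {}jm : (d <= j)%N by move: jm; rewrite mid // => /andP[].
  have -> : (omega^-1 ^+ l) ^+ (j + d - q) = (omega^-1 ^+ l) ^+ j *
     (omega ^+ l) ^ (q%:Z - d%:Z).
    rewrite !exprVn !exprnN -expfzDr ?expf_neq0 //; congr (_ ^ _); lia.
  rewrite [omega^-1 ^+ (l * j)]exprM [omega ^+ (l * k)]exprM !exprVn.
  by move: (exprz _ _) => e; ring.
under eq_bigr do rewrite term.
rewrite exchange_big /= (eq_bigr (fun j : 'I_(2 ^ M) =>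
  (c ^+ M * c ^+ M * c ^+ M * c ^+ M.-1) *
  \sum_(k < 2 ^ M) (middle M j)%:R * z ^+ j * z ^- k *
    (\sum_(l < 2 ^ M) (omega ^+ l) ^+ k * (zeta ^+ l) ^+ (j + d - q)))); last first.
  move=> j _; rewrite -mulr_sumr exchange_big /=; congr (_ * _).
  by apply: eq_bigr => k _; rewrite -mulr_sumr.
rewrite -mulr_sumr.
have inner (j : 'I_(2 ^ M)) : \sum_(k < 2 ^ M) (middle M j)%:R * z ^+ j * z ^- k *
    (\sum_(l < 2 ^ M) (omega ^+ l) ^+ k * (zeta ^+ l) ^+ (j + d - q)) =
  (2 ^ M)%:R * z ^ (q%:Z - d%:Z) *+ (d <= j < 3 * d)%N.
  rewrite mid //; case: (boolP (d <= j < 3 * d)%N) => [/andP[dj jd]|_]; last first.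
    by rewrite mulr0n big1 // => k _; rewrite !mul0r.
  (* The upper end of the window, j < 3d, excludes aliasing. *)
  have jN : (j + d - q < 2 ^ M)%N.
    by move: (nat_of_ord j) dj jd => i di id3; rewrite Nd; lia.
  rewrite (bigD1 (Ordinal jN)) //= [X in _ + X]big1 ?addr0 => [|k /eqP kj].
    rewrite character_sum // eqxx mul1r mulrC exprnN -[z ^+ j]/(z ^ j%:Z) -expfzDr //.
    by congr (_ * z ^ _); lia.
  rewrite character_sum //; case: eqP => [e|_]; last by rewrite mulr0.
  by case: kj; apply: val_inj.
under eq_bigr do rewrite inner.
rewrite (eq_bigr (fun j : 'I_(2 ^ M) => if (d <= j < 3 * d)%N
  then (2 ^ M)%:R * z ^ (q%:Z - d%:Z) else 0)); last by move=> j _; case: ifP.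
rewrite -(big_mkord xpredT (fun j => if (d <= j < 3 * d)%N
  then (2 ^ M)%:R * z ^ (q%:Z - d%:Z) else 0)) -big_mkcond /=.
have -> : \sum_(0 <= j < 2 ^ M | (d <= j < 3 * d)%N) (2 ^ M)%:R * z ^ (q%:Z - d%:Z) =
    \sum_(d <= j < 3 * d) (2 ^ M)%:R * z ^ (q%:Z - d%:Z).
  rewrite [RHS](big_nat_widen _ _ (2 ^ M)); last by rewrite Nd; lia.
  by rewrite [RHS](big_nat_widenl _ 0) //; apply: eq_bigl => j; rewrite andbC.
rewrite sumr_const_nat.
have -> : (3 * d - d = 2 ^ (M - 1))%N.
  have -> : (M - 1 = (M - 2).+1)%N by lia.
  by rewrite expnS -/d; lia.
rewrite -[_ *+ (2 ^ (M - 1))]mulr_natl !mulrA -[RHS]mul1r; congr (_ * _).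
have c4 : c ^+ M * c ^+ M = ((2 ^ M)%:R)^-1.
  by rewrite -exprMn c_sqr exprVn natrX.
have c1 : c ^+ M = c * c ^+ M.-1 by rewrite -exprS prednK.
have nz l : (2 ^ l)%:R != 0 :> R[i] by rewrite pnatr_eq0 expn_eq0.
have N2 : (2 ^ M)%:R = 2 * (2 ^ (M - 1))%:R :> R[i].
  by rewrite -natrM -expnS; congr (_ ^ _)%:R; lia.
have c2 : (Num.sqrt 2)%:C * (c ^+ M * c ^+ M.-1) = 2 * (2 ^ M)%:R^-1 :> R[i].
  rewrite -c4 c1; set e := c ^+ M.-1.
  transitivity ((Num.sqrt 2)%:C * c * (e * e)); first by ring.
  rewrite sqrt2_c; transitivity (2 * (c * c) * (e * e)); last by ring.
  by rewrite c_sqr mulfV ?(pnatr_eq0 _ 2).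
(* Normalisations: two states and two transforms on one side, 2d = 2^(M-1) values of j and the
   character sum 2^M on the other. *)
transitivity (((Num.sqrt 2)%:C * (c ^+ M * c ^+ M.-1)) * (c ^+ M * c ^+ M) *
   ((2 ^ (M - 1))%:R * (2 ^ M)%:R)); first by ring.
rewrite c2 c4 N2; field; exact: nz.
Qed.

End Amplitude.

(** * The block-encoding circuit *)

Definition adj_instr (i : instr) : instr :=
  match i with
  | DGate g w => DGate (adj_name g) w
  | DCGate g c w => DCGate (adj_name g) c w
  | DCtrlU c r => DCtrlUadj c r
  | DCtrlUadj c r => DCtrlU c r
  | DUseF ws => DUseF ws
  end.

(* The first wire of the output of iqft carries the least significant bit. *)
Definition useF_wires (M : nat) : seq nat := rev (iota 0 M) ++ [:: M].

(** Wires are listed downwards here and upwards in [uniform_front], which is later reversed. In the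
    final circuit both lists of powers descend, so a loop that doubles one register can print
    them. *)
Definition middle_front (M : nat) : seq instr :=
  middle_prep M ++ ctrl_powers M (rev (iota 0 M)) ++ iqft M M.

Definition uniform_front (M : nat) : seq instr :=
  hadamards (iota 0 M) ++ ctrl_powers M (iota 0 M) ++ iqft M M.

Definition encoding_circuit (M : nat) : seq instr :=
  middle_front M ++ DUseF (useF_wires M) :: rev (map adj_instr (uniform_front M)).

Definition instr_wf (a k : nat) (i : instr) : bool :=
  match i with
  | DGate g w => name_ok g && (w < a)%N
  | DCGate g c w => [&& name_ok g, (c < a)%N, (w < a)%N & c != w]
  | DCtrlU c _ | DCtrlUadj c _ => (c < a)%N
  | DUseF ws => [&& size ws == k, uniq ws & all (fun w => w < a)%N ws]
  end.

Definition is_DUseF (i : instr) : bool := if i is DUseF _ then true else false.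

Lemma all_flatten (T : Type) (p : pred T) (ss : seq (seq T)) :
  all p (flatten ss) = all (all p) ss.
Proof. by elim: ss => //= s ss IH; rewrite all_cat IH. Qed.

(** * Well-formedness and reversal of descriptions *)

Section CircuitOf.
Variable R : realType.
Implicit Types (D : seq instr) (C : seq (gate R)).

Lemma circuit_wf_cat a n k C C' :
  circuit_wf a n k C -> circuit_wf a n k C' -> circuit_wf a n k (C ++ C').
Proof.
move=> wC wC' i; rewrite size_cat nth_cat => iCC'.
by case: ltnP => [/wC //|Ci]; apply: wC'; rewrite ltn_subLR.
Qed.

Lemma instr_gates_wf a n k i : instr_wf a k i -> circuit_wf a n k (instr_gates R i).
Proof.
have wfn r (g : gate R) : gate_wf a n k g -> circuit_wf a n k (nseq r g).
  by move=> wg j; rewrite size_nseq nth_nseq => ->.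
have wf1 (g : gate R) : gate_wf a n k g -> circuit_wf a n k [:: g] by exact: (wfn 1).
case: i => [g w|g c w|c r|c r|ws] /=.
- by case/andP=> _ wa; apply: wf1; split; [apply: name_mx_unitary|rewrite ltn_addr].
- case/and4P=> _ ca wa cw; apply: wf1; split; rewrite ?ltn_addr //.
  exact/controlled_unitary/name_mx_unitary.
- by move=> ca; apply: wfn.
- by move=> ca; apply: wfn.
- case/and3P=> /eqP sk uw /allP wa; apply: wf1; split => //.
  by apply/allP => w /wa; apply: ltn_addr.
Qed.

Lemma circuit_of_wf a n k D : all (instr_wf a k) D -> circuit_wf a n k (circuit_of R D).
Proof.
elim: D => [|i D IH] //= /andP[wi wD].
by apply: circuit_wf_cat; [exact: instr_gates_wf|exact: IH].
Qed.

Lemma circuit_of_on_ancillas a k D :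
  all (instr_wf a k) D -> all (on_ancillas a) (circuit_of R D).
Proof.
elim: D => [|i D IH] //= /andP[wi wD]; rewrite all_cat IH // andbT.
case: i wi => [g w|g c w|c r|c r|ws] /=.
- by case/andP=> _ ->.
- by case/and4P=> _ -> ->.
- by move=> ca; rewrite all_nseq /= ca orbT.
- by move=> ca; rewrite all_nseq /= ca orbT.
- by case/and3P=> _ _ ->.
Qed.

Lemma circuit_of_noF D : ~~ has is_DUseF D -> ~~ has (@is_useF R) (circuit_of R D).
Proof.
elim: D => [|i D IH] //=; rewrite negb_or has_cat => /andP[iF DF].
rewrite negb_or IH // andbT; case: i iF => //= *; by rewrite has_nseq /= andbF.
Qed.

Lemma circuit_of_adj a k D : all (instr_wf a k) D ->
  circuit_of R (rev (map adj_instr D)) = rev (map (@adj_gate R) (circuit_of R D)).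
Proof.
elim: D => [|i D IH] //= /andP[wi wD].
rewrite rev_cons -cats1 circuit_of_cat IH // map_cat rev_cat; congr (_ ++ _).
rewrite /circuit_of /= cats0; case: i wi => [g w|g c w|c r|c r|ws] /=.
- by case/andP=> ok _; rewrite adj_name_mx.
- by case/and4P=> ok _ _ _; rewrite controlled_adj adj_name_mx.
- by rewrite map_nseq rev_nseq.
- by rewrite map_nseq rev_nseq.
- by [].
Qed.

Lemma hadamards_wf a k ws : all (fun w => w < a)%N ws -> all (instr_wf a k) (hadamards ws).
Proof. by move=> h; rewrite all_map. Qed.

Lemma ctrl_powers_wf a k M ws :
  all (fun w => w < a)%N ws -> all (instr_wf a k) (ctrl_powers M ws).
Proof. by move=> h; rewrite all_map. Qed.

Lemma iqft_wf a k M : (M <= a)%N -> all (instr_wf a k) (iqft M M).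
Proof.
move=> Ma; rewrite /iqft all_flatten all_map; apply/allP => i.
rewrite mem_iota => /andP[_ iM] /=; rewrite (leq_trans iM Ma) all_map /=.
apply/allP => j; rewrite mem_iota /= => ij; rewrite leq_subr; lia.
Qed.

Lemma uniform_front_wf M k : all (instr_wf (M + 1) k) (uniform_front M).
Proof.
have iotaM : all (fun w => w < M + 1)%N (iota 0 M).
  by apply/allP => w; rewrite mem_iota; lia.
rewrite !all_cat hadamards_wf // ctrl_powers_wf // iqft_wf //; lia.
Qed.

Lemma middle_front_wf M k : (1 < M)%N -> all (instr_wf (M + 1) k) (middle_front M).
Proof.
move=> M1; have iotaM : all (fun w => w < M + 1)%N (iota 0 M).
  by apply/allP => w; rewrite mem_iota; lia.
rewrite !all_cat ctrl_powers_wf ?all_rev // iqft_wf ?leq_addr //.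
rewrite hadamards_wf /= ?andbT; first lia.
by apply/andP; split; [lia|apply/allP => w; rewrite mem_rev mem_iota; lia].
Qed.

Lemma encoding_circuit_wf M : (1 < M)%N ->
  all (instr_wf (M + 1) (M + 1)) (encoding_circuit M).
Proof.
move=> M1; rewrite /encoding_circuit all_cat middle_front_wf //= all_rev all_map.
apply/andP; split.
  rewrite size_cat size_rev size_iota eqxx cat_uniq rev_uniq iota_uniq /= orbF andbT.
  rewrite mem_rev mem_iota ltnn andbF all_cat /=.
  by apply/andP; split; [apply/allP => w; rewrite mem_rev mem_iota|]; lia.
have := uniform_front_wf M (M + 1); apply: sub_all => i.
case: i => //= [[||p k]|[||p k]] //=; by rewrite leq_subr => *; lia.
Qed.

End CircuitOf.

(** * The amplitude of the circuit and its bound *)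

Section Block.
Variables (R : realType) (M : nat).
Hypothesis M1 : (1 < M)%N.
Variables (z : R[i]) (F : 'M[R[i]]_(2 ^ (M + 1))).
Hypothesis z1 : z * Num.conj z = 1.
Let W D : 'M[R[i]]_(2 ^ (M + 1)) := circuit_wt (M + 1) z F (circuit_of R D).
Let rev_index (y : nat) : nat := bitsum M (fun w => bit (M + 1) y (M - w.+1)).

Lemma perm_iota_rev : perm_eq (rev (iota 0 M)) (iota 0 M).
Proof. by rewrite perm_rev. Qed.

Lemma uniform_front_col y : W (uniform_front M) y (ket0 (M + 1)) =
  (~~ bit (M + 1) y M)%:R * uniform_amp M z (rev_index y).
Proof.
apply: (iqft_column (phi := fun=> ((Num.sqrt 2)^-1)%:C ^+ M)) => // [|x].
  exact: ltnW.
rewrite hadamards_col ?iota_uniq //; last by apply/allP => w; rewrite mem_iota; lia.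
rewrite size_iota mulrC; congr ((nat_of_bool _)%:R * _).
apply/agree_offP/idP => [h|xM v va].
  by rewrite h ?bit0 ?addn1 // mem_iota ltnn.
rewrite mem_iota leq0n add0n bit0 -leqNgt => Mv.
have -> : v = M by lia.
by rewrite (negPf xM).
Qed.

Lemma middle_front_col y : W (middle_front M) y (ket0 (M + 1)) =
  (~~ bit (M + 1) y M)%:R * middle_amp M z (rev_index y).
Proof.
apply: (iqft_column (phi := fun j => ((Num.sqrt 2)^-1)%:C ^+ M.-1 * (middle M j)%:R));
  [exact: ltnW|exact: perm_iota_rev|move=> x].
rewrite middle_prep_col ?addn1 // /middle !bit_bitsum ?(ltnW M1) //.
by rewrite mulrCA -natrM mulnb andbC.
Qed.

Let x0 : 'I_(2 ^ (M + 1)) := ket0 (M + 1).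

Lemma useF_wires_ok : [/\ size (useF_wires M) = (M + 1)%N, uniq (useF_wires M)
  & all (fun w => w < M + 1)%N (useF_wires M)].
Proof.
have := encoding_circuit_wf M1; rewrite all_cat => /andP[_] /= /andP[] /and3P[/eqP].
by [].
Qed.

Lemma useF_agree x y : agree_off (M + 1) (useF_wires M) x y.
Proof.
apply/agree_offP => w wM; rewrite mem_cat mem_rev mem_iota inE; lia.
Qed.

(** [useF_wires] enumerates every ancilla, so [put] overwrites the whole register and x0 is a mere
    placeholder. *)
Lemma sum_useF (V : nmodType) (G : 'I_(2 ^ (M + 1)) -> V) :
  \sum_y G y = \sum_(l < 2 ^ M) \sum_(f < 2 ^ 1) G (put (useF_wires M) (ketD l f) x0).
Proof.
have [sw uw aw] := useF_wires_ok.
rewrite -(sum_ketD (fun u => G (put (useF_wires M) u x0))).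
rewrite -(sum_agree_off x0 G sw uw aw); apply: eq_bigl => y.
by rewrite useF_agree.
Qed.

Lemma bit_put (l : 'I_(2 ^ M)) (f : 'I_(2 ^ 1)) w : (w < M + 1)%N ->
  bit (M + 1) (put (useF_wires M) (ketD l f) x0) (nth 0 (useF_wires M) w)%N =
  bit (M + 1) (ketD l f) w.
Proof.
by have [sw uw aw] := useF_wires_ok => wM; rewrite -(@bit_subket _ (M + 1)) // subket_put.
Qed.

(** The bit reversal left by the transform cancels against the one in the wiring of F. *)
Lemma rev_index_put (l : 'I_(2 ^ M)) (f : 'I_(2 ^ 1)) :
  rev_index (put (useF_wires M) (ketD l f) x0) = l.
Proof.
rewrite -[RHS](bitsum_ketD l f); apply: eq_bitsum => w wM.
rewrite -bit_put ?ltn_addr //; congr bit.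
by rewrite nth_cat size_rev size_iota wM nth_rev size_iota ?nth_iota //; lia.
Qed.

Lemma bit_put_last (l : 'I_(2 ^ M)) (f : 'I_(2 ^ 1)) :
  bit (M + 1) (put (useF_wires M) (ketD l f) x0) M = odd f.
Proof.
rewrite -(bit_ketD_last l) -bit_put ?addn1 //; congr bit.
by rewrite nth_cat size_rev size_iota ltnn subnn.
Qed.

(** The entry is the matrix element of F between the two front states. Both have flag 0, so F acts
    there as the diagonal of values of f. *)
Lemma encoding_circuit_amplitude (f : R[i] -> R[i]) : diagonal_encoding f F ->
  W (encoding_circuit M) x0 x0 = amplitude M z f.
Proof.
move=> Ff; rewrite /encoding_circuit -cat1s /W instr_wt_cat (instr_wt_cat _ _ _ [:: _]).
rewrite (circuit_of_adj _ (uniform_front_wf M 0)) circuit_wt_adj; last first.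
  apply: circuit_of_noF; rewrite -all_predC !all_cat all_flatten !all_map.
  by rewrite !all_predT; apply/allP => i _ /=; rewrite all_map all_predT.
have key (A B C : 'M[R[i]]_(2 ^ (M + 1))) : (A^t* *m B *m C) x0 x0 =
    \sum_x \sum_y Num.conj (A x x0) * (B x y * C y x0).
  rewrite -mulmxA mxE; apply: eq_bigr => x _.
  by rewrite !mxE mulr_sumr.
rewrite key circuit_wt1 sum_useF; apply: eq_bigr => l _.
rewrite sum_qubit [X in _ + X]big1 ?addr0 => [|y _]; last first.
  have := uniform_front_col (put (useF_wires M) (@ketD M 1 l (1 : 'I_2)) x0).
  by rewrite bit_put_last mul0r => ->; rewrite conjC0 mul0r.
have := uniform_front_col (put (useF_wires M) (@ketD M 1 l (0 : 'I_2)) x0).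
rewrite bit_put_last mul1r rev_index_put => ->.
rewrite -mulr_sumr -mulrA; congr (_ * _).
have [sw uw aw] := useF_wires_ok.
have mf y : circuit_wt (M + 1) z F (circuit_of R (middle_front M)) y x0 =
  (~~ bit (M + 1) y M)%:R * middle_amp M z (rev_index y) := middle_front_col y.
have FE l' : apply_on (M + 1) (useF_wires M) F
    (put (useF_wires M) (@ketD M 1 l (0 : 'I_2)) x0)
    (put (useF_wires M) (@ketD M 1 l' (0 : 'I_2)) x0) =
  if l' == l then f (expi (2 * pi / (2 ^ M)%:R) ^+ l) else 0.
  rewrite apply_onE useF_agree !subket_put //.
  have -> : (0 : 'I_2) = ket0 1 :> 'I_(2 ^ 1) by exact: val_inj.
  by rewrite Ff omegaX; case: eqP => [->|].
rewrite sum_useF (bigD1 l) //= [X in _ + X]big1 ?addr0 => [|l' l'l]; rewrite sum_qubit.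
all: rewrite !mf !bit_put_last mul0r mulr0 addr0 mul1r /= FE rev_index_put.
- by rewrite eqxx.
- by rewrite (negPf l'l) mul0r.
Qed.

(** Column 0 of a unitary matrix has norm 1; no computation with the explicit amplitudes is
    involved. *)
Lemma sum_amp_sqr D amp : all (instr_wf (M + 1) (M + 1)) D ->
  (forall y, W D y x0 = (~~ bit (M + 1) y M)%:R * amp (rev_index y)) ->
  F \is unitarymx -> \sum_(l < 2 ^ M) `|amp l| ^+ 2 = 1.
Proof.
move=> wD Damp FF.
have /unitarymxP/mulmx1C : W D \is unitarymx.
  apply: circuit_wt_unitary => //; first exact: circuit_of_on_ancillas wD.
  exact: circuit_of_wf wD.
move=> /matrixP/(_ x0 x0); rewrite mxE [in RHS]mxE eqxx mulr1n => <-.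
rewrite sum_useF; apply: eq_bigr => l _; rewrite sum_qubit !mxE !Damp !bit_put_last.
by rewrite !rev_index_put /= !mul0r mulr0 addr0 !mul1r normCK mulrC.
Qed.

(** Cauchy-Schwarz for two unit vectors, obtained termwise from 2ab <= a^2 + b^2. *)
Lemma amplitude_le (h : R[i] -> R[i]) (e : R[i]) : F \is unitarymx -> 
  (forall l, `|h (expi (2 * pi / (2 ^ M)%:R) ^+ l)| <= e) ->
  `|amplitude M z h| <= e.
Proof.
move=> FF he; rewrite /amplitude; apply: le_trans (ler_norm_sum _ _ _) _.
have e0 : 0 <= e := le_trans (normr_ge0 _) (he 0).
have u2 := sum_amp_sqr (uniform_front_wf M (M + 1)) uniform_front_col FF.
have m2 := sum_amp_sqr (middle_front_wf (M + 1) M1) middle_front_col FF.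
apply: (@le_trans _ _ (\sum_(l < 2 ^ M)
    e / 2 * (`|uniform_amp M z l| ^+ 2 + `|middle_amp M z l| ^+ 2))); last first.
  by rewrite -mulr_sumr big_split /= u2 m2 mulrDr mulr1 -splitr.
apply: ler_sum => l _; rewrite 2!normrM norm_conjC.
have uv (u v : R[i]) : `|u| * `|v| <= (`|u| ^+ 2 + `|v| ^+ 2) / 2.
  move: `|u| `|v| (normr_real u) (normr_real v) => a b ra rb.
  rewrite ler_pdivlMr ?ltr0n // -subr_ge0.
  have -> : a ^+ 2 + b ^+ 2 - a * b * 2 = (a - b) ^+ 2 by ring.
  by rewrite real_exprn_even_ge0 // rpredB.
have {uv} := uv (uniform_amp M z l) (middle_amp M z l).
move: `|uniform_amp _ _ _| (normr_ge0 (uniform_amp M z l)) => a a0.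
move: `|middle_amp _ _ _| (normr_ge0 (middle_amp M z l)) => b b0 ab.
rewrite [a * _]mulrC -[_ * a * b]mulrA -[e / 2 * _]mulrA [2^-1 * _]mulrC.
by apply: ler_pM; rewrite ?mulr_ge0.
Qed.

End Block.

(** * Operator norms *)

Section OperatorNorm.
Variable R : realType.

Lemma norm_modulus (x : R[i]) : `|x| = (modulus x)%:C.
Proof. by rewrite /modulus normc_def. Qed.

Lemma modulus_ge0 (x : R[i]) : 0 <= modulus x.
Proof. by rewrite -ler0c -norm_modulus. Qed.

Lemma le_modulus (x : R[i]) (e : R) : (modulus x <= e) = (`|x| <= e%:C).
Proof. by rewrite norm_modulus lecR. Qed.

Lemma S1_conj (x : R[i]) : x * Num.conj x = 1 -> modulus x = 1.
Proof.
rewrite -normCK => /eqP; rewrite sqrp_eq1 ?normr_ge0 // norm_modulus => /eqP.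
exact: complexI.
Qed.

Lemma sqr_vnorm k (v : 'cV[R[i]]_k) : (vnorm v ^+ 2)%:C = (v^t* *m v) 0 0.
Proof.
rewrite sqr_sqrtr ?sumr_ge0 // => [|i _]; last exact: sqr_ge0.
rewrite rmorph_sum mxE; apply: eq_bigr => i _ /=.
by rewrite rmorphXn /= -norm_modulus normCK !mxE mulrC.
Qed.

Lemma vnorm_ge0 k (v : 'cV[R[i]]_k) : 0 <= vnorm v.
Proof. exact: sqrtr_ge0. Qed.

Lemma vnorm_unitary k (P : 'M[R[i]]_k) (v : 'cV_k) : P \is unitarymx ->
  vnorm (P *m v) = vnorm v.
Proof.
move=> /unitarymxP/mulmx1C PP; apply/eqP.
rewrite -(eqrXn2 (n := 2)) ?vnorm_ge0 //; apply/eqP; apply: complexI.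
by rewrite !sqr_vnorm trmx_mul map_mxM mulmxA -[_ *m _ *m P]mulmxA PP mulmx1.
Qed.

Lemma vnorm_diag_le k (d : 'rV[R[i]]_k) (v : 'cV_k) (e : R) : 0 <= e ->
  (forall i, modulus (d 0 i) <= e) -> vnorm (diag_mx d *m v) <= e * vnorm v.
Proof.
move=> e0 de; rewrite -[e]ger0_norm // -sqrtr_sqr -sqrtrM ?sqr_ge0 // ler_wsqrtr //.
rewrite mulr_sumr; apply: ler_sum => i _; rewrite -exprMn.
rewrite lerXn2r ?nnegrE ?mulr_ge0 ?modulus_ge0 // mul_diag_mx mxE.
rewrite le_modulus normrM rmorphM /= !norm_modulus -!rmorphM lecR.
by rewrite ler_wpM2r ?modulus_ge0.
Qed.

Lemma opnorm_diag_le k (P : 'M[R[i]]_k) (d : 'rV[R[i]]_k) (e : R) :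
  P \is unitarymx -> 0 <= e -> (forall i, modulus (d 0 i) <= e) ->
  opnorm (invmx P *m diag_mx d *m P) <= e.
Proof.
move=> PP e0 de; apply: ge_sup => [|_ [v v1 <-]].
  exists (vnorm (invmx P *m diag_mx d *m P *m 0)), 0 => //=.
  rewrite /vnorm big1 ?sqrtr0 ?ler01 // => i _.
  by rewrite mxE /modulus normr0 expr0n.
rewrite -!mulmxA vnorm_unitary ?invmx_unitary ?trmxC_unitary //.
apply: le_trans (vnorm_diag_le _ e0 de) _; rewrite vnorm_unitary //.
by rewrite -[leRHS]mulr1 ler_wpM2l.
Qed.

End OperatorNorm.

(** * Diagonalisation of the black box *)

Section Spectral.
Variables (R : realType) (k : nat) (U : 'M[R[i]]_k).
Hypothesis UU : U \is unitarymx.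
Let P := spectralmx U.
Let lam i := spectral_diag U 0 i.

Lemma unitary_spectral : U = invmx P *m diag_mx (spectral_diag U) *m P.
Proof.
apply/orthomx_spectralP/normalmxP.
by rewrite (unitarymxP UU) (mulmx1C (unitarymxP UU)).
Qed.

Lemma eigenvalue_unit i : lam i * Num.conj (lam i) = 1.
Proof.
have PP : P \is unitarymx := spectral_unitarymx U.
have DD : diag_mx (spectral_diag U) \is unitarymx.
  have -> : diag_mx (spectral_diag U) = P *m U *m invmx P.
    by rewrite [in RHS]unitary_spectral !mulmxA mulmxV ?spectral_unit // mul1mx
      -mulmxA mulmxV ?spectral_unit // mulmx1.
  by rewrite !mul_unitarymx // invmx_unitary // trmxC_unitary.
have /unitarymxP/matrixP/(_ i i) := DD.
by rewrite tr_diag_mx map_diag_mx mul_diag_mx !mxE eqxx !mulr1n.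
Qed.

(** As P is unitary, one basis diagonalises both U and its adjoint; the second half serves the
    controlled adjoint gates. *)
Lemma eigenvector_col i :
  U *m col i (invmx P) = lam i *: col i (invmx P) /\
  U^t* *m col i (invmx P) = Num.conj (lam i) *: col i (invmx P).
Proof.
have PP : P \is unitarymx := spectral_unitarymx U.
have colD (d : 'rV[R[i]]_k) :
    (invmx P *m diag_mx d *m P) *m col i (invmx P) = d 0 i *: col i (invmx P).
  rewrite [in LHS]colE mulmxA -[_ *m P *m _]mulmxA mulmxV ?spectral_unit // mulmx1.
  by rewrite -colE; apply/colP => j; rewrite mul_mx_diag !mxE mulrC.
split; first by rewrite {1}unitary_spectral colD.
rewrite {1}unitary_spectral !trmx_mul !map_mxM invmx_unitary // trmxCK.
rewrite tr_diag_mx map_diag_mx mulmxA -invmx_unitary // colD mxE.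
by [].
Qed.

Lemma diagonalize_block (B : 'M[R[i]]_k) (b : 'I_k -> R[i]) :
  (forall i, B *m col i (invmx P) = b i *: col i (invmx P)) ->
  B = invmx P *m diag_mx (\row_i b i) *m P.
Proof.
move=> Bb; rewrite -[LHS]mulmx1 -(mulVmx (spectral_unit U)) mulmxA; congr (_ *m _).
apply/matrixP => j i; rewrite mul_mx_diag !mxE mulrC.
have := congr1 (fun v : 'cV_k => v j 0) (Bb i); rewrite !mxE => <-.
by apply: eq_bigr => l _; rewrite mxE.
Qed.

End Spectral.

(** * From eigenvalue estimates to the block encoding *)

Section BlockEncoding.
Variables (R : realType) (m : nat).
Let M := (m + 2)%N.
Let d := (2 ^ m)%N.

Lemma M_gt1 : (1 < M)%N.
Proof. by rewrite /M addn2. Qed.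

Lemma amplitude_laurent (z : R[i]) (beta : int -> R[i]) : z * Num.conj z = 1 ->
  (Num.sqrt 2)%:C * amplitude M z (laurent d beta) = laurent d beta z.
Proof.
move=> z1; rewrite /amplitude.
under eq_bigr do rewrite /laurent mulr_sumr mulr_suml.
rewrite exchange_big mulr_sumr; apply: eq_bigr => q _ /=.
have qd : (q <= 2 * 2 ^ (M - 2))%N by rewrite addnK -ltnS.
have := amplitude_monomial (ltnW M_gt1) z1 M_gt1 qd.
rewrite addnK => <-; rewrite mulrCA; congr (_ * _).
by rewrite mulr_sumr; apply: eq_bigr => l _; rewrite [_ * (beta _ * _)]mulrCA !mulrA.
Qed.

Lemma amplitudeB (z : R[i]) g h :
  amplitude M z (fun w => g w - h w) = amplitude M z g - amplitude M z h.
Proof. by rewrite -sumrB; apply: eq_bigr => l _; rewrite mulrBr mulrBl. Qed.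

Lemma amplitude_approx (f : R[i] -> R[i]) (z : R[i]) beta (e : R)
    (F : 'M[R[i]]_(2 ^ (M + 1))) : F \is unitarymx ->
  z * Num.conj z = 1 ->
  (forall w, S1 w -> modulus (f w - laurent d beta w) <= e) ->
  modulus (f z - (Num.sqrt 2)%:C * amplitude M z f) <= (1 + Num.sqrt 2) * e.
Proof.
move=> FF z1 fe; set g := laurent d beta.
have -> : f z - (Num.sqrt 2)%:C * amplitude M z f =
    (f z - g z) - (Num.sqrt 2)%:C * amplitude M z (fun w => f w - g w).
  by rewrite amplitudeB mulrBr amplitude_laurent // opprB addrA subrK.
rewrite le_modulus rmorphM rmorphD rmorph1 mulrDl mul1r /=.
apply: le_trans (ler_normB _ _) _; apply: lerD.
  by rewrite -le_modulus; apply/fe/S1_conj.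
rewrite normrM [X in X * _]ger0_norm ?ler0c ?sqrtr_ge0 //.
rewrite ler_wpM2l ?ler0c ?sqrtr_ge0 //.
apply: (amplitude_le M_gt1 z1 FF) => l; rewrite -le_modulus; apply/fe/S1_conj.
by rewrite rmorphXn -exprMn expi_conj expr1n.
Qed.

Lemma laurent0 (z : R[i]) : laurent d (fun=> 0) z = 0.
Proof. by rewrite /laurent big1 // => k _; rewrite mul0r. Qed.

Local Open Scope ereal_scope.

(** The zero polynomial is a competitor with error at most 1. Finiteness makes [fine] faithful in
    the final bound. *)
Lemma best_error_fin (f : R[i] -> R[i]) : supnorm f <= 1 ->
  best_error d f \is a fin_num.
Proof.
move=> f1; apply: fin_real; apply/andP; split.
  apply: (@lt_le_trans _ _ 0%E); first exact: ltNy0.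
  apply: le_ereal_inf_tmp => _ [beta _ <-].
  apply: (@le_trans _ _ (modulus (f 1%R - laurent d beta 1%R)%R)%:E).
    by rewrite lee_fin modulus_ge0.
  apply: ereal_sup_ubound; exists 1%R => //.
  by apply: S1_conj; rewrite rmorph1 mulr1.
apply: le_lt_trans (ltry 1); apply: le_trans f1.
apply: ereal_inf_lbound; exists (fun=> 0%R) => //; congr ereal_sup.
by apply: eq_imagel => z _; rewrite laurent0 subr0.
Qed.

(** Dividing by 1 + sqrt 2 turns the estimate into a lower bound for every competitor, hence for the
    infimum. An infinite error is trivial, and minus infinity is excluded by the point 1 of the
    circle. *)
Lemma amplitude_best (f : R[i] -> R[i]) (z : R[i])
    (F : 'M[R[i]]_(2 ^ (M + 1))) : F \is unitarymx ->
  (z * Num.conj z = 1)%R -> supnorm f <= 1 ->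
  (modulus (f z - (Num.sqrt 2)%:C * amplitude M z f) <=
    (1 + Num.sqrt 2) * fine (best_error d f))%R.
Proof.
move=> FF z1 f1; have s0 : (0 < 1 + Num.sqrt 2 :> R)%R.
  by rewrite ltr_pwDl ?sqrtr_ge0.
rewrite [leRHS]mulrC -ler_pdivrMr // -lee_fin fineK ?best_error_fin //.
apply: le_ereal_inf_tmp => _ [beta _ <-].
have ub w : S1 w -> (modulus (f w - laurent d beta w))%:E <=
    supnorm (fun z => f z - laurent d beta z)%R.
  by move=> w1; apply: ereal_sup_ubound; exists w.
case: supnorm ub => [e| |] ub; [|by rewrite leey|].
  rewrite lee_fin ler_pdivrMr // [leRHS]mulrC.
  by apply: (amplitude_approx (beta := beta) FF z1) => w /ub; rewrite lee_fin.
by have := ub 1%R (S1_conj (etrans (congr1 _ (rmorph1 _)) (mulr1 _))).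
Qed.

Local Close Scope ereal_scope.

Lemma encoding_circuit_block n (f : R[i] -> R[i]) (U : 'M[R[i]]_(2 ^ n))
    (F : 'M[R[i]]_(2 ^ (M + 1))) :
  (supnorm f <= 1)%E -> U \is unitarymx -> F \is unitarymx ->
  diagonal_encoding f F ->
  block_encoding (Num.sqrt 2) (M + 1) ((1 + Num.sqrt 2) * fine (best_error d f))
    (circuit_mx (M + 1) U F (circuit_of R (encoding_circuit M))) (fun_mx f U).
Proof.
move=> f1 UU FF Ff; set W := circuit_mx _ _ _ _.
have wf := encoding_circuit_wf M_gt1.
have wfC : circuit_wf (M + 1) n (M + 1) (circuit_of R (encoding_circuit M)).
  exact: circuit_of_wf wf.
have anc : all (on_ancillas (M + 1)) (circuit_of R (encoding_circuit M)).
  exact: circuit_of_on_ancillas wf.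
split; first exact: circuit_mx_unitary.
set P := spectralmx U; pose lam i := spectral_diag U 0 i.
have lam1 i : lam i * Num.conj (lam i) = 1 by exact: eigenvalue_unit.
have -> : anc_block W = invmx P *m diag_mx (\row_i amplitude M (lam i) f) *m P.
  apply: diagonalize_block => // i; set v := col i (invmx P).
  have [Uv Uv'] := eigenvector_col UU i.
  have := sector_circuit F Uv Uv' wfC anc.
  move=> Wv; apply/colP => j.
  have := Wv (ket0 (M + 1)) j (ket0 (M + 1)).
  rewrite (encoding_circuit_amplitude M_gt1 (lam i) Ff) => h.
  rewrite [RHS]mxE -h mxE; by apply: eq_bigr => l _; rewrite mxE.
rewrite /fun_mx scalemxAl scalemxAr -mulmxBl -mulmxBr.
have -> : diag_mx (map_mx f (spectral_diag U)) -
    (Num.sqrt 2)%:C *: diag_mx (\row_i amplitude M (lam i) f) =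
  diag_mx (\row_i (f (lam i) - (Num.sqrt 2)%:C * amplitude M (lam i) f)).
  by apply/matrixP => i j; rewrite !mxE; case: eqP => _;
    rewrite ?mulr1n // !mulr0n mulr0 subr0.
apply: opnorm_diag_le; first exact: spectral_unitarymx.
  (* The error is nonnegative because it bounds a modulus, here for the eigenvalue 1. *)
  apply: le_trans (modulus_ge0 _) (amplitude_best FF _ f1).
  exact: (etrans (congr1 _ (rmorph1 _)) (mulr1 _)).
by move=> i; rewrite mxE; apply: (amplitude_best FF).
Qed.

End BlockEncoding.

(** * Computing the description on the random access machine *)

Local Open Scope nat_scope.

Lemma updE (M : memory) x v y : upd M x v y = if y == x then v else M y.
Proof. by rewrite /upd /=. Qed.

(** For loop-free code without indirect addressing, final memory, output and size checks are
    computable functions, so verifying a loop body is evaluation plus arithmetic. *)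
Fixpoint straight (p : ram) : bool :=
  match p with
  | RSet _ _ | RAdd _ _ _ | RSub _ _ _ | REmit _ => true
  | RSeq p q => straight p && straight q
  | _ => false
  end.

Fixpoint final (p : ram) (M : memory) : memory :=
  match p with
  | RSet x c => upd M x c
  | RAdd x y z => upd M x (M y + M z)
  | RSub x y z => upd M x (M y - M z)
  | RSeq p q => final q (final p M)
  | _ => M
  end.

Fixpoint emitted (p : ram) (M : memory) : seq nat :=
  match p with
  | REmit x => [:: M x]
  | RSeq p q => emitted p M ++ emitted q (final p M)
  | _ => [::]
  end.

(** Only constants and sums can leave a bounded memory; truncated subtraction cannot. *)
Fixpoint safe (B : nat) (p : ram) (M : memory) : bool :=
  match p with
  | RSet x c => c < B
  | RAdd x y z => M y + M z < B
  | RSeq p q => safe B p M && safe B q (final p M)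
  | _ => true
  end.

Fixpoint steps (p : ram) : nat :=
  if p is RSeq p q then steps p + steps q else 1.

Definition bounded (B : nat) (M : memory) : Prop := forall x, M x < B.

Lemma bitlen_le L v : v < 2 ^ L -> 0 < L -> bitlen v <= L.
Proof.
move=> vL L0; rewrite /bitlen; case: v vL => [|v] vL; first by rewrite trunc_log0.
by rewrite -(ltn_exp2l _ _ (isT : 1 < 2)); apply: leq_ltn_trans vL; apply: trunc_logP.
Qed.

(** A step handles at most two numbers of at most L bits, whence the cost 2L. *)
Lemma straight_exec L p M o : 0 < L -> straight p -> bounded (2 ^ L) M ->
  safe (2 ^ L) p M ->
  bounded (2 ^ L) (final p M) /\ exists2 t, t <= steps p * (2 * L) &
    exec p (M, o) (final p M, o ++ emitted p M) t.
Proof.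
move=> L0; have upd_bounded N x v : bounded (2 ^ L) N -> v < 2 ^ L ->
    bounded (2 ^ L) (upd N x v).
  by move=> bN vL y; rewrite updE; case: ifP.
have bl := fun v vL => @bitlen_le L v vL L0.
elim: p M o => [x c|x y z|x y z| | |x|p IHp q IHq| ] //= M o; rewrite ?cats0.
- move=> _ bM cL; split; first exact: upd_bounded.
  by exists (bitlen c); [have := bl _ cL; lia|constructor].
- move=> _ bM sL; split; first exact: upd_bounded.
  exists (bitlen (M y) + bitlen (M z)); last by constructor.
  by have := bl _ (bM y); have := bl _ (bM z); lia.
- move=> _ bM _; split; first by apply: upd_bounded => //; have := bM y; lia.
  exists (bitlen (M y) + bitlen (M z)); last by constructor.
  by have := bl _ (bM y); have := bl _ (bM z); lia.
- move=> _ bM _; split => //; exists (bitlen (M x)); first by have := bl _ (bM x); lia.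
  by rewrite cats1; constructor.
- case/andP=> sp sq bM /andP[fp fq].
  have [bp [t tp ep]] := IHp M o sp bM fp.
  have [bq [u uq eq]] := IHq _ (o ++ emitted p M) sq bp fq.
  split => //; exists (t + u); first by rewrite mulnDl leq_add.
  by rewrite catA; apply: ExecSeq ep eq.
Qed.

(** Hoare triple for total correctness that also tracks the appended output, the size of the numbers
    in memory and a time bound. *)
Definition triple (L : nat) (P : memory -> Prop) (p : ram) (Q : memory -> Prop)
    (out : seq nat) (T : nat) : Prop :=
  forall M o, bounded (2 ^ L) M -> P M ->
  exists M' t, [/\ exec p (M, o) (M', o ++ out) t, bounded (2 ^ L) M', Q M' & t <= T].

Lemma triple_straight L (P Q : memory -> Prop) p out : 0 < L -> straight p ->
  (forall M, P M -> [/\ safe (2 ^ L) p M, Q (final p M) & emitted p M = out]) ->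
  triple L P p Q out (steps p * (2 * L)).
Proof.
move=> L0 sp h M o bM /h[fp Qp <-].
by have [bp [t tp ep]] := straight_exec o L0 sp bM fp; exists (final p M), t; split.
Qed.

Lemma triple_seq L P Q S p q o1 o2 T1 T2 :
  triple L P p Q o1 T1 -> triple L Q q S o2 T2 ->
  triple L P (RSeq p q) S (o1 ++ o2) (T1 + T2).
Proof.
move=> hp hq M o bM /(hp _ o bM)[M1 [t1 [e1 b1 Q1 le1]]].
have [M2 [t2 [e2 b2 Q2 le2]]] := hq _ (o ++ o1) b1 Q1.
exists M2, (t1 + t2); split=> //; last exact: leq_add.
by rewrite catA; apply: ExecSeq e1 e2.
Qed.

Lemma triple_while L x p n (Inv : nat -> memory -> Prop) out T : 0 < L ->
  (forall i M, i <= n -> Inv i M -> M x = n - i) ->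
  (forall i, i < n -> triple L (Inv i) p (Inv i.+1) (out i) T) ->
  triple L (Inv 0) (RWhile x p) (Inv n) (flatten [seq out i | i <- iota 0 n])
    (n * (L + T) + L).
Proof.
move=> L0 counter body.
have bl := fun v vL => @bitlen_le L v vL L0.
suff main k i : i + k = n -> triple L (Inv i) (RWhile x p) (Inv n)
    (flatten [seq out j | j <- iota i k]) (k * (L + T) + L) by exact: main.
elim: k i => [|k IH] i ikn M o bM Ii.
  have Mx : M x = 0 by rewrite (counter i) //; lia.
  exists M, (bitlen (M x)); rewrite /= cats0; split=> //; first exact: ExecWhileStop.
    by rewrite -ikn addn0.
  exact: bl.
have [M1 [t1 [e1 b1 I1 le1]]] := body i ltac:(lia) M o bM Ii.
have [M2 [t2 [e2 b2 I2 le2]]] := IH i.+1 ltac:(lia) M1 (o ++ out i) b1 I1.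
exists M2, (bitlen (M x) + t1 + t2); split=> //.
  rewrite /= catA; apply: ExecWhileStep e1 e2.
  by rewrite (counter i) //; lia.
by have := bl _ (bM x); rewrite mulSn; lia.
Qed.

Lemma triple_out L P p Q o o' T T' : o = o' -> T <= T' ->
  triple L P p Q o T -> triple L P p Q o' T'.
Proof.
move=> <- TT h M out bM /(h _ out bM)[M1 [t1 [e1 b1 I1 le1]]].
by exists M1, t1; split=> //; apply: leq_trans TT.
Qed.

Lemma triple_weaken L (P P' Q Q' : memory -> Prop) p o T :
  (forall M, P' M -> P M) -> (forall M, Q M -> Q' M) ->
  triple L P p Q o T -> triple L P' p Q' o T.
Proof.
move=> PP QQ h M out bM /PP/(h _ out bM)[M1 [t1 [e1 b1 /QQ I1 le1]]].
by exists M1, t1.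
Qed.

Fixpoint block (ps : seq ram) (q : ram) : ram :=
  if ps is p :: ps then RSeq p (block ps q) else q.

Definition emit_const (c : nat) : ram := RSeq (RSet 9 c) (REmit 9).

Lemma rev_iota k n : rev (iota k n) = [seq k + n - t.+1 | t <- iota 0 n].
Proof.
apply: (@eq_from_nth _ 0) => [|i]; rewrite size_rev size_iota ?size_map ?size_iota //.
move=> i_n; rewrite nth_rev size_iota // nth_iota; last lia.
by rewrite (nth_map 0) ?size_iota // nth_iota //; lia.
Qed.

Lemma encode_cat D D' : encode (D ++ D') = encode D ++ encode D'.
Proof. by rewrite /encode map_cat flatten_cat. Qed.

Lemma encode_flatten (T : Type) (F : T -> seq instr) s :
  encode (flatten [seq F i | i <- s]) = flatten [seq encode (F i) | i <- s].
Proof. by elim: s => //= i s IH; rewrite encode_cat IH. Qed.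

Lemma encode_map (T : Type) (F : T -> instr) s :
  encode [seq F i | i <- s] = flatten [seq instr_code (F i) | i <- s].
Proof. by rewrite /encode -map_comp. Qed.

(** * The loops of the program *)

Section Program.
Variable m : nat.
Let M := m + 2.
Let L := M + 3.

(* Cell 1 holds 1, 2 holds M, 8 holds 0, 3 is the counter of the outer loops and
   11 that of the inner ones; 4 and 9 are scratch, 5 holds a power of 2, 6 the
   number of finished rounds, and 7 and 10 the second wire and the level of a
   controlled phase. *)
Definition regs (c : nat) (N : memory) : Prop :=
  [/\ N 1 = 1, N 2 = M, N 8 = 0 & N 3 = c].

Lemma bnd8 : 8 < 2 ^ L.
Proof. by rewrite /L /M expnD; have := expn_gt0 2 m; rewrite expnD; lia. Qed.

Lemma bndM : 2 * M + 3 < 2 ^ L.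
Proof. by have := ltn_expl M (isT : 1 < 2); rewrite /L expnD /M; lia. Qed.

(** Powers of two are the largest numbers in play, and cell 5 is doubled once more after its last
    use; the margin in L covers this. *)
Lemma bnd_pow t : t <= M.+1 -> 2 ^ t + 2 ^ t < 2 ^ L.
Proof. by move=> tM; rewrite addnn -mul2n -expnS ltn_exp2l // /L; lia. Qed.

Lemma L_gt0 : 0 < L.
Proof. by rewrite /L addn3. Qed.

Ltac solve_list := repeat (apply: (f_equal2 (@cons nat)); [lia|]); reflexivity.

Definition hadamards_body : ram :=
  block [:: emit_const 0; emit_const 0; RAdd 4 3 1; REmit 4] (RSub 3 3 1).

Lemma hadamards_loop :
  triple L (regs m) (RWhile 3 hadamards_body) (regs 0)
    (encode (hadamards (rev (iota 2 m)))) (m * (L + 14 * L) + L).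
Proof.
rewrite /hadamards rev_iota -map_comp encode_map.
have := @triple_while L 3 hadamards_body m (fun i => regs (m - i))
  (fun i => instr_code (DGate Hadamard (2 + m - i.+1))) (14 * L).
rewrite subn0 subnn; apply.
- exact: L_gt0.
- by move=> i N _ [].
- move=> i im; apply: triple_out (erefl _) _ (triple_straight L_gt0 _ _) => //.
    by rewrite /=; lia.
  move=> N [N1 N2 N8 N3]; rewrite /= !updE /= !(N1, N2, N8, N3).
  have := bndM; have := bnd8 => b8 bM; split.
  - lia.
  - by split; rewrite ?updE //=; lia.
  - solve_list.
Qed.

Definition powers_body (op : nat) : ram :=
  block [:: RSub 3 3 1; emit_const op; REmit 3; REmit 5] (RAdd 5 5 5).

(** As the wire w descends, the exponent M - w - 1 climbs from 0, so cell 5 starts at 1 and doubles.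
    Opcodes 2 and 3 share the loop. *)
Lemma powers_loop op : op < 8 ->
  triple L (fun N => regs M N /\ N 5 = 1) (RWhile 3 (powers_body op)) (regs 0)
    (flatten [seq [:: op; w; 2 ^ (M - w.+1)] | w <- rev (iota 0 M)])
    (M * (L + 12 * L) + L).
Proof.
move=> op8; rewrite rev_iota -map_comp.
have := @triple_while L 3 (powers_body op) M
  (fun i N => regs (M - i) N /\ N 5 = 2 ^ i)
  (fun i => [:: op; 0 + M - i.+1; 2 ^ (M - (0 + M - i.+1).+1)]) (12 * L).
rewrite subn0 subnn expn0 => h.
apply: triple_weaken (h _ _ _) => //; first by move=> N [].
- exact: L_gt0.
- by move=> i N _ [[]].
- move=> i iM; apply: triple_out (erefl _) _ (triple_straight L_gt0 _ _) => //.
    by rewrite /=; lia.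
  move=> N [[N1 N2 N8 N3] N5]; rewrite /= !updE /= !(N1, N2, N8, N3, N5).
  have b8 := bnd8; have bi := bnd_pow (leqW (ltnW iM)); split.
  - by rewrite /= andbT; apply/andP; split => //; lia.
  - by split; first split; rewrite ?updE ?expnS //=; lia.
  - rewrite (_ : M - (0 + M - i.+1).+1 = i); last lia.
    by rewrite (_ : M - i - 1 = 0 + M - i.+1) //; lia.
Qed.

Definition iqft_inner : ram :=
  block [:: emit_const 1; emit_const 2; RSub 4 5 1; REmit 4; REmit 10; REmit 6;
    REmit 7; RAdd 7 7 1; RAdd 10 10 1; RAdd 5 5 5] (RSub 11 11 1).

Definition iqft_body : ram :=
  RSeq (block [:: emit_const 0; emit_const 0; REmit 6; RSub 3 3 1; RSub 11 3 8;
    RAdd 7 6 1; RSet 10 2] (RSet 5 4))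
  (RSeq (RWhile 11 iqft_inner) (RAdd 6 6 1)).

(** Round s treats k = i + 1 + s, of level k - i + 1 = s + 2; cell 5 is 2 to that level. *)
Definition iqft_inv (i s : nat) (N : memory) : Prop :=
  [/\ regs (M - i.+1) N, N 6 = i, N 7 = i.+1 + s, N 10 = s.+2 &
    N 5 = 2 ^ s.+2 /\ N 11 = M - i.+1 - s].

Lemma iqft_inner_loop i : i < M ->
  triple L (iqft_inv i 0) (RWhile 11 iqft_inner) (iqft_inv i (M - i.+1))
    (encode [seq inv_cphase i k | k <- iota i.+1 (M - i.+1)])
    (M * (L + 26 * L) + L).
Proof.
move=> iM; have -> : iota i.+1 (M - i.+1) = [seq i.+1 + s | s <- iota 0 (M - i.+1)].
  by rewrite -iotaDl addn0.
rewrite -map_comp encode_map.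
apply: triple_out (erefl _) _ (triple_while (T := 26 * L) L_gt0 _ _).
- by rewrite leq_add2r leq_mul2r leq_subr orbT.
- by move=> s N _ [_ _ _ _ []].
- move=> s sM; apply: triple_out (erefl _) _ (triple_straight L_gt0 _ _) => //.
    by rewrite /=; lia.
  move=> N [[N1 N2 N8 N3] N6 N7 N10 [N5 N11]].
  rewrite /= !updE /= !(N1, N2, N8, N3, N5, N6, N7, N10, N11).
  have b8 := bnd8; have bM := bndM.
  have bs : 2 ^ s.+2 + 2 ^ s.+2 < 2 ^ L by apply: bnd_pow; lia.
  split.
  - lia.
  - split; rewrite ?updE //=; try lia.
    by split; last lia; rewrite addnn -mul2n -expnS.
  - rewrite /inv_cphase /= (_ : i.+1 + s - i = s.+1) //; lia.
Qed.

Lemma iqft_loop :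
  triple L (fun N => regs M N /\ N 6 = 0) (RWhile 3 iqft_body) (regs 0)
    (encode (iqft M M)) (M * (L + (M * (L + 26 * L) + 40 * L)) + L).
Proof.
rewrite /iqft encode_flatten.
have := @triple_while L 3 iqft_body M (fun i N => regs (M - i) N /\ N 6 = i)
  (fun i => encode (iqft_block M i)) (M * (L + 26 * L) + 40 * L).
rewrite subn0 subnn => h.
apply: triple_weaken (h _ _ _) => //; first by move=> N [].
- exact: L_gt0.
- by move=> i N _ [[]].
- move=> i iM; apply: triple_out _ _ (triple_seq (Q := iqft_inv i 0)
    (o1 := [:: 0; 0; i]) (T1 := 20 * L) _
    (triple_seq (o2 := [::]) (T2 := 2 * L) (iqft_inner_loop iM) _)).
  - by rewrite cats0.
  - lia.
  - apply: triple_out (erefl _) _ (triple_straight L_gt0 _ _) => //.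
      by rewrite /=; lia.
    move=> N [[N1 N2 N8 N3] N6]; rewrite /= !updE /= !(N1, N2, N8, N3, N6).
    have b8 := bnd8; have bM := bndM.
    split=> //; first lia.
    by split; [split|..]; try split; rewrite ?updE /= ?N1 ?N2 ?N8 ?N3 ?N6 //; lia.
  - apply: triple_out (erefl _) _ (triple_straight L_gt0 _ _) => //.
      by rewrite /=; lia.
    move=> N [[N1 N2 N8 N3] N6 _ _ _]; rewrite /= N1 N6.
    have bM := bndM; split=> //; first lia.
    by split; [split|]; rewrite ?updE //= addn1.
Qed.

Definition useF_body : ram := block [:: RSub 3 3 1] (REmit 3).

Lemma useF_loop :
  triple L (regs M) (RWhile 3 useF_body) (regs 0) (rev (iota 0 M))
    (M * (L + 4 * L) + L).
Proof.
have := @triple_while L 3 useF_body M (fun i => regs (M - i))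
  (fun i => [:: M - i.+1]) (4 * L).
rewrite subn0 subnn -[flatten _]/(flatten (map _ _)) flatten_map1.
rewrite rev_iota; apply.
- exact: L_gt0.
- by move=> i N _ [].
- move=> i im; apply: triple_out (erefl _) _ (triple_straight L_gt0 _ _) => //.
    by rewrite /=; lia.
  move=> N [N1 N2 N8 N3]; rewrite /= !updE /= !(N1, N2, N8, N3).
  by split=> //; [split; rewrite ?updE //=; lia|solve_list].
Qed.

(** In reversed order the counter r in cell 11 determines the arguments: with i in cell 3, the
    second wire is i + r and the level r + 1. The adjoint numerator is 1, so no power of 2 is
    kept. *)
Definition qft_inner : ram :=
  block [:: emit_const 1; emit_const 2; emit_const 1; RAdd 10 11 1; REmit 10;
    REmit 3; RAdd 7 3 11; REmit 7] (RSub 11 11 1).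

Definition qft_body : ram :=
  RSeq (block [:: RSub 3 3 1] (RAdd 11 6 8))
  (RSeq (RWhile 11 qft_inner)
    (block [:: emit_const 0; emit_const 0; REmit 3] (RAdd 6 6 1))).

Lemma adj_inv_cphase i k :
  adj_instr (inv_cphase i k) = DCGate (Phase 1 (k - i).+1) i k.
Proof. by rewrite /= subKn // expn_gt0. Qed.

Lemma qft_inner_loop t : t < M ->
  triple L (fun N => [/\ regs (M - t.+1) N, N 6 = t & N 11 = t])
    (RWhile 11 qft_inner) (fun N => regs (M - t.+1) N /\ N 6 = t)
    (encode (rev [seq adj_instr (inv_cphase (M - t.+1) k) | k <- iota (M - t.+1).+1 t]))
    (M * (L + 24 * L) + L).
Proof.
move=> tM; rewrite -map_rev rev_iota -map_comp encode_map.
have := @triple_while L 11 qft_inner t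
  (fun s N => [/\ regs (M - t.+1) N, N 6 = t & N 11 = t - s])
  (fun s => instr_code
     (adj_instr (inv_cphase (M - t.+1) ((M - t.+1).+1 + t - s.+1)))) (24 * L).
rewrite subn0 => h.
apply: triple_weaken (triple_out (erefl _) _ (h _ _ _)) => //.
- by move=> N [].
- by rewrite leq_add2r leq_mul2r (ltnW tM) orbT.
- exact: L_gt0.
- by move=> s N _ [].
- move=> s st; apply: triple_out (erefl _) _ (triple_straight L_gt0 _ _) => //.
    by rewrite /=; lia.
  move=> N [[N1 N2 N8 N3] N6 N11]; rewrite adj_inv_cphase.
  rewrite /= !updE /= !(N1, N2, N8, N3, N6, N11).
  have b8 := bnd8; have bM := bndM; split.
  - lia.
  - by split; [split|..]; rewrite ?updE //=; lia.
  - solve_list.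
Qed.

(** Reversal puts the Hadamard gate of each block last and visits the blocks downwards: round t
    treats wire M - t - 1, which has t later partners. *)
Lemma rev_adj_iqft : rev (map adj_instr (iqft M M)) =
  flatten [seq rev [seq adj_instr (inv_cphase (M - t.+1) k) |
    k <- iota (M - t.+1).+1 t] ++ [:: DGate Hadamard (M - t.+1)] | t <- iota 0 M].
Proof.
rewrite /iqft map_flatten rev_flatten -!map_comp -map_rev rev_iota -map_comp.
congr flatten; apply/eq_in_map => t; rewrite mem_iota => tM.
rewrite /= -map_comp rev_cons cats1; congr (rcons (rev [seq _ | _ <- iota _ _]) _).
lia.
Qed.

Lemma qft_loop :
  triple L (fun N => regs M N /\ N 6 = 0) (RWhile 3 qft_body) (regs 0)
    (encode (rev (map adj_instr (iqft M M))))
    (M * (L + (M * (L + 24 * L) + 40 * L)) + L).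
Proof.
rewrite rev_adj_iqft encode_flatten.
have := @triple_while L 3 qft_body M (fun t N => regs (M - t) N /\ N 6 = t)
  (fun t => encode (rev [seq adj_instr (inv_cphase (M - t.+1) k) |
    k <- iota (M - t.+1).+1 t] ++ [:: DGate Hadamard (M - t.+1)]))
  (M * (L + 24 * L) + 40 * L).
rewrite subn0 subnn => h.
apply: triple_weaken (h _ _ _) => //; first by move=> N [].
- exact: L_gt0.
- by move=> i N _ [[]].
- move=> t tM; apply: triple_out _ _ (triple_seq (o1 := [::]) (T1 := 4 * L) _
    (triple_seq (o2 := [:: 0; 0; M - t.+1]) (T2 := 12 * L) (qft_inner_loop tM) _)).
  - by rewrite encode_cat.
  - lia.
  - apply: triple_out (erefl _) _ (triple_straight L_gt0 _ _) => //.
      by rewrite /=; lia.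
    move=> N [[N1 N2 N8 N3] N6]; rewrite /= !updE /= !(N1, N2, N8, N3, N6).
    have bM := bndM.
    split=> //; first lia.
    by split; [split|..]; rewrite ?updE /= ?N1 ?N2 ?N8 ?N3 ?N6 //; lia.
  - apply: triple_out (erefl _) _ (triple_straight L_gt0 _ _) => //.
      by rewrite /=; lia.
    move=> N [[N1 N2 N8 N3] N6]; rewrite /= !updE /= !(N1, N2, N8, N3, N6).
    have b8 := bnd8; have bM := bndM; split=> //; first lia.
    by split; [split|]; rewrite ?updE //= addn1.
Qed.

Definition final_body : ram :=
  block [:: RSub 3 3 1; emit_const 0; emit_const 0] (REmit 3).

Lemma final_loop :
  triple L (regs M) (RWhile 3 final_body) (regs 0)
    (encode (hadamards (rev (iota 0 M)))) (M * (L + 12 * L) + L).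
Proof.
rewrite /hadamards rev_iota -map_comp encode_map.
have := @triple_while L 3 final_body M (fun i => regs (M - i))
  (fun i => instr_code (DGate Hadamard (0 + M - i.+1))) (12 * L).
rewrite subn0 subnn; apply.
- exact: L_gt0.
- by move=> i N _ [].
- move=> i im; apply: triple_out (erefl _) _ (triple_straight L_gt0 _ _) => //.
    by rewrite /=; lia.
  move=> N [N1 N2 N8 N3]; rewrite /= !updE /= !(N1, N2, N8, N3).
  have b8 := bnd8; split.
  - lia.
  - by split; rewrite ?updE //=; lia.
  - solve_list.
Qed.

End Program.

Definition emits (cs : seq nat) (q : ram) : ram := block (map emit_const cs) q.

(** The literal lists are instruction codes: 0 0 0 is a Hadamard gate on wire 0, 0 1 1 an X gate on
    wire 1, and 1 1 0 1 its controlled version. [RAdd 3 2 8] adds the zero cell to M in order to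
    reset the counter. *)
Definition describe : ram :=
  block [:: block [:: RSet 1 1; RSet 9 2; RAdd 2 0 9; RSub 3 2 9; emit_const 0;
                      emit_const 0] (emit_const 0);
            RWhile 3 hadamards_body;
            emits [:: 0; 1; 1; 1; 1; 0; 1] (RSeq (RAdd 3 2 8) (RSet 5 1));
            RWhile 3 (powers_body 2);
            RSeq (RAdd 3 2 8) (RSet 6 0);
            RWhile 3 iqft_body;
            block [:: emit_const 4; RAdd 4 2 1; REmit 4] (RAdd 3 2 8);
            RWhile 3 useF_body;
            block [:: REmit 2; RAdd 3 2 8] (RSet 6 0);
            RWhile 3 qft_body;
            RSeq (RAdd 3 2 8) (RSet 5 1);
            RWhile 3 (powers_body 3);
            RAdd 3 2 8]
    (RWhile 3 final_body).

(** * Correctness and running time of the whole program *)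

Section Describe.
Variable m : nat.
Let M := m + 2.
Let L := M + 3.

Lemma encode_encoding_circuit :
  encode (encoding_circuit M) =
  [:: 0; 0; 0] ++ encode (hadamards (rev (iota 2 m))) ++
  [:: 0; 1; 1; 1; 1; 0; 1] ++
  flatten [seq [:: 2; w; 2 ^ (M - w.+1)] | w <- rev (iota 0 M)] ++ [::] ++
  encode (iqft M M) ++ [:: 4; M + 1] ++ rev (iota 0 M) ++ [:: M] ++
  encode (rev (map adj_instr (iqft M M))) ++ [::] ++
  flatten [seq [:: 3; w; 2 ^ (M - w.+1)] | w <- rev (iota 0 M)] ++ [::] ++
  encode (hadamards (rev (iota 0 M))).
Proof.
rewrite /encoding_circuit /middle_front /middle_prep /uniform_front -[DUseF _ :: _]cat1s.
have -> ws : hadamards (0 :: ws) = [:: DGate Hadamard 0] ++ hadamards ws by [].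
rewrite !map_cat !rev_cat !encode_cat addnK.
have -> : rev (map adj_instr (ctrl_powers M (iota 0 M))) =
    [seq DCtrlUadj w (2 ^ (M - w.+1)) | w <- rev (iota 0 M)].
  by rewrite -map_rev /ctrl_powers -map_rev -map_comp.
have -> : rev (map adj_instr (hadamards (iota 0 M))) = hadamards (rev (iota 0 M)).
  by rewrite /hadamards -map_comp map_rev.
have -> : encode [:: DUseF (useF_wires M)] = [:: 4; M + 1] ++ rev (iota 0 M) ++ [:: M].
  by rewrite /encode /= cats0 size_cat size_rev size_iota.
rewrite [encode (ctrl_powers _ _)]encode_map.
rewrite [encode [seq DCtrlUadj w _ | w <- rev (iota 0 M)]]encode_map /=.
move: (encode (hadamards (rev (iota 2 m)))) (encode (iqft M M)) => s1 s2.
move: (encode (rev _)) (encode (hadamards _)) => s3 s4.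
by rewrite /= -!catA.
Qed.

Lemma describe_computes : exists t,
  computes describe m (encode (encoding_circuit M)) t /\ t <= 1000 * L ^ 3.
Proof.
have L0 : 0 < L by rewrite /L addn3.
have b8 : 8 < 2 ^ L := bnd8 m; have bM : 2 * M + 3 < 2 ^ L := bndM m.
pose start (N : memory) := N 0 = m /\ forall x, 0 < x -> N x = 0.
have h : exists2 T, T <= 1000 * L ^ 3 &
    triple L start describe (fun=> True) (encode (encoding_circuit M)) T.
  rewrite encode_encoding_circuit.
  (* The running time stays an existential variable, assembled by [triple_seq] and bounded only at
     the end. *)
  eexists; last first.
    apply: triple_seq.
      apply: (triple_straight (Q := regs m m) L0) => // N [N0 Nx].
      rewrite /= !updE /= N0; split=> //; first lia.
      by split; rewrite ?updE /= ?N0 ?Nx //; lia.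
    apply: triple_seq; first exact: hadamards_loop.
    apply: triple_seq.
      apply: (triple_straight (Q := fun N => regs m M N /\ N 5 = 1) L0) => // N [N1 N2 N8 N3].
      rewrite /= !updE /= N2 N8; split=> //; first lia.
      by split; first split; rewrite ?updE /= ?N1 ?N2 ?N8 ?addn0.
    apply: triple_seq; first exact: powers_loop.
    apply: triple_seq.
      apply: (triple_straight (Q := fun N => regs m M N /\ N 6 = 0) L0) => // N [N1 N2 N8 N3].
      rewrite /= N2 N8; split=> //; first lia.
      by split; first split; rewrite ?updE /= ?N1 ?N2 ?N8 ?addn0.
    apply: triple_seq; first exact: iqft_loop.
    apply: triple_seq.
      apply: (triple_straight (Q := regs m M) L0) => // N [N1 N2 N8 N3].
      rewrite /= !updE /= N1 N2 N8; split=> //; first lia.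
      by split; rewrite ?updE /= ?N1 ?N2 ?N8 ?addn0.
    apply: triple_seq; first exact: useF_loop.
    apply: triple_seq.
      apply: (triple_straight (Q := fun N => regs m M N /\ N 6 = 0) L0) => // N [N1 N2 N8 N3].
      rewrite /= N2 N8; split=> //; first lia.
      by split; first split; rewrite ?updE /= ?N1 ?N2 ?N8 ?addn0.
    apply: triple_seq; first exact: qft_loop.
    apply: triple_seq.
      apply: (triple_straight (Q := fun N => regs m M N /\ N 5 = 1) L0) => // N [N1 N2 N8 N3].
      rewrite /= N2 N8; split=> //; first lia.
      by split; first split; rewrite ?updE /= ?N1 ?N2 ?N8 ?addn0.
    apply: triple_seq; first exact: powers_loop.
    apply: triple_seq.
      apply: (triple_straight (Q := regs m M) L0) => // N [N1 N2 N8 N3].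
      rewrite /= N2 N8; split=> //; first lia.
      by split; rewrite ?updE /= ?N1 ?N2 ?N8 ?addn0.
    by apply: triple_weaken (@final_loop m).
  rewrite /= -/M -/L.
  have ML : M <= L by rewrite /L; lia.
  have mL : m <= L by rewrite /L /M; lia.
  have L1 : L <= L * L by rewrite leq_pmull.
  have L2 : L * L <= L ^ 3 by rewrite expnS expnS expn1 leq_pmull.
  have ML2 : M * L <= L * L by rewrite leq_mul2r ML orbT.
  have mL2 : m * L <= L * L by rewrite leq_mul2r mL orbT.
  have MML : M * (M * L) <= L ^ 3 by rewrite expnS expnS expn1 !leq_mul.
  move: L M ML mL L1 L2 ML2 mL2 MML {L0 b8 bM start} => L' M'; clear; nia.
case: h => T TL h.
have [|//|M' [t [e _ _ tT]]] := h (upd (fun=> 0) 0 m) [::].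
- by move=> x; rewrite updE; case: ifP => _; [rewrite (leq_trans _ bM) // /M|]; lia.
- by split; [rewrite updE|move=> x x0; rewrite updE; case: eqP x0 => // ->].
by exists t; split; [exists M'|exact: leq_trans TL].
Qed.

End Describe.

Lemma cubic_bound A : exists c, forall m, 0 < m -> A * (m + 5) ^ 3 <= c * m ^ c.
Proof.
(* For m >= 1, m + 5 <= 6m and 6^3 = 216; the same c must serve as coefficient and as exponent. *)
exists (3 + 216 * A) => m m0; apply: (@leq_trans (216 * A * m ^ 3)).
  rewrite [216 * A]mulnC -mulnA leq_mul2l (_ : 216 = 6 ^ 3) // -expnMn.
  by rewrite leq_exp2r ?orbT //; apply/orP; right; lia.
by rewrite leq_mul ?leq_addl // leq_pexp2l // leq_addr.
Qed.

(** * Gate counts *)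

Section Counts.
Variables (R : realType) (M : nat).
Hypothesis M1 : 1 < M.
Implicit Types (C : seq (gate R)).

Lemma elementary_count C : all (@is_elementary R) C ->
  [/\ count (@is_ctrlU R) C = 0, count (@is_ctrlUadj R) C = 0,
      count (@is_useF R) C = 0 & count (@is_elementary R) C = size C].
Proof.
elim: C => //= g C IH /andP[eg /IH[-> -> -> ->]].
by case: g eg.
Qed.

(** The repetition counts of the controlled powers add up to this number; for N = m + 2 it is 4d -
    1. *)
Lemma all_ones N : bitsum N (fun=> true) = 2 ^ N - 1.
Proof.
elim: N => [|N IH]; first by rewrite /bitsum big_ord0.
by rewrite bitsumS IH expnS; have := expn_gt0 2 N; lia.
Qed.

Lemma ctrl_powers_count ws : perm_eq ws (iota 0 M) ->
  let C := circuit_of R (ctrl_powers M ws) in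
  [/\ count (@is_ctrlU R) C = 2 ^ M - 1, count (@is_ctrlUadj R) C = 0,
      count (@is_useF R) C = 0 & count (@is_elementary R) C = 0].
Proof.
move=> ws_perm; have sumE : \sum_(w <- ws) 2 ^ (M - w.+1) = 2 ^ M - 1.
  rewrite (perm_big _ ws_perm) -all_ones /bitsum -[M in iota 0 M]subn0.
  rewrite -/(index_iota 0 M) big_mkord.
  by apply: eq_bigr => i _; rewrite mul1n.
rewrite /= -sumE; elim: ws {ws_perm sumE} => [|w ws [h1 h2 h3 h4]].
  by rewrite big_nil.
rewrite /circuit_of /= !count_cat !count_nseq big_cons -/(circuit_of _ _).
by rewrite h1 h2 h3 h4 /= mul1n !mul0n.
Qed.

Lemma hadamards_elementary ws : all (@is_elementary R) (circuit_of R (hadamards ws)).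
Proof. by elim: ws. Qed.

Lemma iqft_elementary i : all (@is_elementary R) (circuit_of R (iqft M i)).
Proof.
elim: i => // i IH; rewrite iqftS circuit_of_cat all_cat IH /=.
by elim: (iota _ _).
Qed.

Lemma iqft_size i : i <= M -> size (circuit_of R (iqft M i)) <= i * M.
Proof.
elim: i => // i IH iM; rewrite iqftS circuit_of_cat size_cat mulSn addnC.
apply: leq_add; last exact/IH/ltnW.
rewrite /= (_ : size _ = M - i.+1); first lia.
by rewrite -[RHS](size_iota i.+1); elim: (iota _ _) => //= k ks ->.
Qed.

Lemma front_count D ws : all (@is_elementary R) (circuit_of R D) ->
  perm_eq ws (iota 0 M) ->
  let C := circuit_of R (D ++ ctrl_powers M ws ++ iqft M M) in
  [/\ count (@is_ctrlU R) C = 2 ^ M - 1, count (@is_ctrlUadj R) C = 0,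
      count (@is_useF R) C = 0 &
      count (@is_elementary R) C <= size (circuit_of R D) + M * M].
Proof.
move=> eD ws_perm C; rewrite /C (circuit_of_cat _ D) (circuit_of_cat _ (ctrl_powers M ws)).
rewrite !count_cat; have [-> -> -> ->] := elementary_count eD.
have [-> -> -> ->] := ctrl_powers_count ws_perm.
have [-> -> -> ->] := elementary_count (iqft_elementary M).
by rewrite !addn0; split=> //; rewrite leq_add2l iqft_size.
Qed.

Lemma encoding_circuit_count :
  let C := circuit_of R (encoding_circuit M) in
  [/\ count (@is_ctrlU R) C = 2 ^ M - 1, count (@is_ctrlUadj R) C = 2 ^ M - 1,
      count (@is_useF R) C = 1 &
      count (@is_elementary R) C <= 2 * M * M + 2 * M + 1].
Proof.
have -> : circuit_of R (encoding_circuit M) = circuit_of R (middle_front M) ++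
    UseF (useF_wires M) :: rev (map (@adj_gate R) (circuit_of R (uniform_front M))).
  rewrite /encoding_circuit circuit_of_cat; congr (_ ++ _).
  by rewrite -(circuit_of_adj _ (uniform_front_wf M 0)).
have adjU : preim (@adj_gate R) (@is_ctrlU R) =1 @is_ctrlUadj R by case.
have adjUadj : preim (@adj_gate R) (@is_ctrlUadj R) =1 @is_ctrlU R by case.
have adjF : preim (@adj_gate R) (@is_useF R) =1 @is_useF R by case.
have adjE : preim (@adj_gate R) (@is_elementary R) =1 @is_elementary R by case.
have hs ws : size (circuit_of R (hadamards ws)) = size ws by elim: ws => //= w ws ->.
have mid : all (@is_elementary R) (circuit_of R (middle_prep M)).
  by rewrite /middle_prep circuit_of_cat all_cat hadamards_elementary.
have midE : size (circuit_of R (middle_prep M)) = M + 1.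
  by rewrite /middle_prep circuit_of_cat size_cat hs /= size_rev size_iota; lia.
have := front_count mid (perm_iota_rev M); rewrite -/(middle_front M) midE.
have := front_count (hadamards_elementary (iota 0 M)) (perm_refl _).
rewrite -/(uniform_front M) hs size_iota.
move: (circuit_of R (middle_front M)) (circuit_of R (uniform_front M)) => C1 C2 /=.
move=> [u1 u2 u3 u4] [v1 v2 v3 v4].
rewrite !count_cat /= !count_rev !count_map.
rewrite (eq_count adjU) (eq_count adjUadj) (eq_count adjF) (eq_count adjE).
rewrite u1 u2 u3 v1 v2 v3 !addn0 !add0n.
by split=> //; apply: leq_trans (leq_add v4 u4) _; lia.
Qed.

End Counts.

Local Close Scope nat_scope.

Theorem theorem4 (R : realType) :
  exists (p : ram) (c K : nat), forall m : nat, (0 < m)%N ->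
  exists (D : seq instr) (t : nat),
    let d := (2 ^ m)%N in
    let C := circuit_of R D in
    [/\ computes p m (encode D) t /\ (t <= c * m ^ c)%N,
        (forall n : nat, circuit_wf (m + 3) n (m + 2 + 1) C),
        [/\ count (@is_ctrlU R) C = (4 * d - 1)%N,
            count (@is_ctrlUadj R) C = (4 * d - 1)%N,
            count (@is_useF R) C = 1%N &
            (count (@is_elementary R) C <= K * m ^ 2)%N] &
        forall (n : nat) (f : R[i] -> R[i])
          (U : 'M[R[i]]_(2 ^ n)) (F : 'M[R[i]]_(2 ^ (m + 2 + 1))),
          (supnorm f <= 1)%E ->
          U \is unitarymx ->
          F \is unitarymx ->
          diagonal_encoding f F ->
          block_encoding (Num.sqrt 2) (m + 3)
            ((1 + Num.sqrt 2) * fine (best_error d f))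
            (circuit_mx (m + 3) U F C) (fun_mx f U)].
Proof.
have [c c_bound] := cubic_bound 1000.
(* With M = m + 2 the count 2M^2 + 2M + 1 is 2m^2 + 10m + 13, at most 25 m^2 for m >= 1, with
   equality at m = 1. *)
exists describe, c, 25%N => m m0; have [t [comp tL]] := describe_computes m.
exists (encoding_circuit (m + 2)), t => d C.
have aM : (m + 3 = m + 2 + 1)%N by rewrite -addnA.
have [cU cUadj cF cE] := encoding_circuit_count R (M_gt1 m).
have dM : (2 ^ (m + 2) = 4 * d)%N by rewrite mulnC expnD.
rewrite -dM; split.
- split=> //; apply: leq_trans tL _; rewrite -addnA; exact: c_bound.
- by move=> n; rewrite aM; apply: circuit_of_wf (encoding_circuit_wf (M_gt1 m)).
- split=> //; apply: leq_trans cE _; rewrite expnS expn1; nia.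
- by rewrite aM => n f U F; apply: encoding_circuit_block.
Qed.
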